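(* (a) If $A,B\in M_2(\mathbb R)$ are normal and skew-aligned, then $\mathcal M_{\mathbb R}(\exp(A)\exp(B))<\|A\|_2+\|B\|_2$. (b) If $A,B\in M_2(\mathbb C)$ are normal and skew-aligned, then $\mathcal M_{\mathbb C}(\exp(A)\exp(B))<\|A\|_2+\|B\|_2$.
   Context: $\|\cdot\|_2$ is the operator norm. $\mathcal M_{\mathbb F}(A)=\inf\{\sum_{i=1}^k\|B_i\|_2: k\ge1,\ B_i\in M_2(\mathbb F),\ \exp(B_k)\cdots\exp(B_1)=A\}$ (Magnus exponent). Normal $A,B$ are skew-aligned if, after a simultaneous unitary conjugation, $A=r_1\begin{pmatrix}e^{i\eta}\cos t&-e^{i\theta}\sin t\\ e^{i\eta}\sin t&e^{i\theta}\cos t\end{pmatrix}$, $B=r_2\begin{pmatrix}e^{i\eta}\cos t&-e^{i\phi}\sin t\\ e^{i\eta}\sin t&e^{i\phi}\cos t\end{pmatrix}$ with $r_1,r_2>0$, $t\in(0,\pi)$, $\eta,\theta,\phi\in[0,2\pi)$, $\phi\ne\theta$. *)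

(* Defs.v *)
(* MathComp-Analysis (realType R) + mathcomp-real-closed complex R[i]. *)
From HB Require Import structures.
From mathcomp Require Import all_boot all_order all_algebra.
From mathcomp Require Import all_classical all_reals all_analysis.
From mathcomp Require Import complex.
Set Implicit Arguments. Unset Strict Implicit. Unset Printing Implicit Defensive.
Import Order.TTheory GRing.Theory Num.Theory.
Import numFieldNormedType.Exports.
Local Open Scope ring_scope.
Local Open Scope classical_set_scope.

(* Matrix exponential of a 2x2 matrix over a numeric field F, as the limit of
   the partial sums of sum_k A^k / k! (topology of 'M[F]_2 = entrywise). *)
Definition mexp {F : numFieldType} (A : 'M[F]_2) : 'M[F]_2 :=
  limn (series (fun k : nat => (k`!%:R)^-1 *: A ^+ k)).

(* Euclidean norms of vectors in R^2 and C^2. *)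
Definition vnormR {R : realType} (v : 'cV[R]_2) : R :=
  Num.sqrt (\sum_(i < 2) (v i 0) ^+ 2).
Definition vnormC {R : realType} (v : 'cV[R[i]]_2) : R :=
  Num.sqrt (\sum_(i < 2) (ComplexField.Normc.normc (v i 0)) ^+ 2).

(* Operator norm ||A||_2 = sup { ||A v|| : ||v|| = 1 }. *)
Definition opnormR {R : realType} (A : 'M[R]_2) : R :=
  sup [set vnormR (A *m v) | v in [set v : 'cV[R]_2 | vnormR v = 1]].
Definition opnormC {R : realType} (A : 'M[R[i]]_2) : R :=
  sup [set vnormC (A *m v) | v in [set v : 'cV[R[i]]_2 | vnormC v = 1]].

(* Magnus exponent: inf { sum_i nrm B_i : k >= 1, exp(B_k) ... exp(B_1) = A },
   where the list s = [:: B_1; ...; B_k]. *)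
Definition magnus {F : numFieldType} {R : realType} (nrm : 'M[F]_2 -> R)
    (A : 'M[F]_2) : R :=
  inf [set x : R | exists s : seq 'M[F]_2,
         [/\ s != [::], \prod_(B <- rev s) mexp B = A & x = \sum_(B <- s) nrm B]].

Definition magnusR {R : realType} (A : 'M[R]_2) : R := magnus (@opnormR R) A.
Definition magnusC {R : realType} (A : 'M[R[i]]_2) : R := magnus (@opnormC R) A.

(* Conjugate transpose. *)
Definition adjC {R : rcfType} (A : 'M[R[i]]_2) : 'M[R[i]]_2 :=
  (map_mx (fun z : R[i] => z^*) A)^T.

Definition normal_mxR {R : realType} (A : 'M[R]_2) : Prop := A *m A^T = A^T *m A.
Definition normal_mxC {R : rcfType} (A : 'M[R[i]]_2) : Prop :=
  A *m adjC A = adjC A *m A.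

(* Embedding of real matrices into complex ones. *)
Definition cplx_mx {R : rcfType} (A : 'M[R]_2) : 'M[R[i]]_2 :=
  map_mx (fun x : R => Complex x 0) A.

(* e^{ix} *)
Definition expi {R : realType} (x : R) : R[i] := Complex (cos x) (sin x).

(* The 2x2 matrix [[a, b], [c, d]]. *)
Definition mx22 {T : Type} (a b c d : T) : 'M[T]_2 :=
  \matrix_(i < 2, j < 2)
    if (i : nat) == 0%N then (if (j : nat) == 0%N then a else b)
    else (if (j : nat) == 0%N then c else d).

(* Normal-form matrix r [[e^{i eta} cos t, - e^{i th} sin t], [e^{i eta} sin t, e^{i th} cos t]]. *)
Definition skew_form {R : realType} (r t eta th : R) : 'M[R[i]]_2 :=
  (Complex r 0) *: mx22 (expi eta * Complex (cos t) 0) (- (expi th * Complex (sin t) 0))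
                        (expi eta * Complex (sin t) 0) (expi th * Complex (cos t) 0).

(* Skew-aligned pair (after a simultaneous unitary conjugation). *)
Definition skew_aligned {R : realType} (A B : 'M[R[i]]_2) : Prop :=
  exists U : 'M[R[i]]_2, U *m adjC U = 1%:M /\
  exists r1 r2 t eta theta phi : R,
    [/\ [/\ 0 < r1, 0 < r2 & 0 < t < pi],
        [/\ 0 <= eta < 2 * pi, 0 <= theta < 2 * pi, 0 <= phi < 2 * pi & phi != theta],
        U *m A *m adjC U = skew_form r1 t eta theta
      & U *m B *m adjC U = skew_form r2 t eta phi].

(* Main.v *)
(** Skew alignment means that, up to scaling, A and B are unitary matrices X and Y sending a common
    unit vector v, not an eigenvector, to the same vector w.  At the junction of the two segments the
    first-order cost of a perturbation Z is Re (w^* Z v), because for large N the norm of N (X + Y) - Z is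
    2 N - Re (w^* Z v) + o(1).  The rank one contraction Z best aligned with v transported along exp (s X)
    and w transported along exp (- s X)^* satisfies
    Re (w^* exp (- s X) Z exp (s X) v) > 1 unless det X = 1, and det X <> det Y, so X or Y provides such a
    Z.  Playing Z during a short time d away from the junction and undoing it at the junction saves a cost
    of order d, while the resulting group element is corrected exactly at a cost O(d ^ 2). *)

(* With Z played right at the junction the gain is at most 1 and can only balance the cost of Z; the
   excess comes from the distance [s] to the junction and is of order s ^ 2. Hence the order of the
   choices: [s] is fixed first, which fixes a gain k > 1, then N, large depending on k, and only
   then d. The correction of order d ^ 2 has to be an exact product of exponentials, since the
   Magnus exponent asks for the group element itself; it comes from elimination rather than from a
   matrix logarithm. Over R the unitary basis of the skew form is complex, and conjugation by it
   leaves the real matrices. The real case therefore keeps only what conjugation cannot destroy,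
   namely orthogonality, distinct determinants and not being scalar, and rebuilds a real vector v
   from these. The estimates themselves are common to R and R[i]. *)
Require Import Defs.
From HB Require Import structures.
From mathcomp Require Import all_boot all_order all_algebra.
From mathcomp Require Import all_classical all_reals all_analysis.
From mathcomp Require Import complex zify ring lra.
Import Order.TTheory GRing.Theory Num.Theory.
Import numFieldNormedType.Exports.
Local Open Scope ring_scope.

Set Implicit Arguments.
Unset Strict Implicit.
Unset Printing Implicit Defensive.
Local Open Scope classical_set_scope.

(* Common interface to R and R[i]; the two factors in [exp_near1] are there so that the polar form
   can be used without the functional equation of the complex exponential. *)
Record rcfield (R : realType) (F : numFieldType) := Rcfield {
  emb : {rmorphism R -> F};
  cj : {rmorphism F -> F};
  av : F -> R;
  embE : forall x, emb (av x) = `|x|;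
  ler_emb : {mono emb : x y / x <= y};
  emb_pos : forall e : F, 0 < e -> exists e', e = emb e';
  cjK : involutive cj;
  cj_emb : forall x, cj (emb x) = emb x;
  mul_cj : forall x, x * cj x = emb (av x ^+ 2);
  abs_cvg : forall u : nat -> F, cvgn (series (fun n => av (u n))) ->
    exists l, (fun n => av (series u n - l)) @ \oo --> (0 : R);
  exp_near1 : forall d, av (d - 1) <= 2^-1 -> exists z1 z2 d1 d2,
    [/\ d = d1 * d2, av z1 <= 4 * av (d - 1), av z2 <= 4 * av (d - 1),
      (fun n => av (series (fun k => (k`!%:R)^-1 * z1 ^+ k) n - d1)) @ \oo --> (0 : R)
    & (fun n => av (series (fun k => (k`!%:R)^-1 * z2 ^+ k) n - d2)) @ \oo --> (0 : R)] }.

Lemma cvg_sum0 (R : realType) (I : Type) (r : seq I) (f : I -> nat -> R) :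
  (forall i, f i @ \oo --> (0 : R)) ->
  (fun n => \sum_(i <- r) f i n) @ \oo --> (0 : R).
Proof.
move=> h; elim: r => [|i r IH].
  by rewrite (_ : (fun n => _) = fun=> 0) ?funeqE; [exact: cvg_cst|move=> n; rewrite big_nil].
rewrite (_ : (fun n => _) = fun n => f i n + \sum_(j <- r) f j n).
  by rewrite -[X in _ --> X]addr0; exact: cvgD.
by apply/funext => n; rewrite big_cons.
Qed.

(** * Absolute values, the entrywise norm, and convergence of matrix sequences *)

Section AbsoluteValue.
Variables (R : realType) (F : numFieldType) (K : rcfield R F).
Local Notation emb := (emb K).
Local Notation cj := (cj K).
Local Notation av := (av K).
Implicit Types x y : F.

Lemma emb_inj : injective emb.
Proof. exact: fmorph_inj. Qed.

Lemma av_ge0 x : 0 <= av x.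
Proof. by rewrite -(ler_emb K) rmorph0 embE. Qed.
Hint Resolve av_ge0 : core.

Lemma av0 : av 0 = 0.
Proof. by apply: emb_inj; rewrite embE rmorph0 normr0. Qed.

Lemma av1 : av 1 = 1.
Proof. by apply: emb_inj; rewrite embE rmorph1 normr1. Qed.

Lemma av_eq0 x : (av x == 0) = (x == 0).
Proof. by rewrite -(inj_eq emb_inj) embE rmorph0 normr_eq0. Qed.

Lemma avN x : av (- x) = av x.
Proof. by apply: emb_inj; rewrite !embE normrN. Qed.

Lemma avM x y : av (x * y) = av x * av y.
Proof. by apply: emb_inj; rewrite rmorphM /= !embE normrM. Qed.

Lemma avD x y : av (x + y) <= av x + av y.
Proof. by rewrite -(ler_emb K) rmorphD /= !embE ler_normD. Qed.

Lemma avB x y : av (x - y) <= av x + av y.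
Proof. by rewrite -[av y]avN avD. Qed.

Lemma av_distC x y : av (x - y) = av (y - x).
Proof. by rewrite -avN opprB. Qed.

Lemma avV x : av x^-1 = (av x)^-1.
Proof. by apply: emb_inj; rewrite fmorphV /= !embE normfV. Qed.

Lemma av_emb (a : R) : av (emb a) = `|a|.
Proof.
by apply: (pexpIrn (n := 2)) => //; rewrite ?nnegrE //; apply: emb_inj;
  rewrite -mul_cj cj_emb real_normK ?num_real // rmorphXn.
Qed.

Lemma av_cj x : av (cj x) = av x.
Proof.
by apply: (pexpIrn (n := 2)) => //; rewrite ?nnegrE //; apply: emb_inj;
  rewrite -!mul_cj cjK mulrC.
Qed.

Lemma av_nat n : av n%:R = n%:R.
Proof. by rewrite -(rmorph_nat emb) av_emb normr_nat. Qed.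

Lemma av_sum I (r : seq I) (P : pred I) (f : I -> F) :
  av (\sum_(i <- r | P i) f i) <= \sum_(i <- r | P i) av (f i).
Proof.
elim/big_ind2 : _ => //; first by rewrite av0.
by move=> x1 x2 y1 y2 h1 h2; apply: le_trans (avD _ _) (lerD _ _).
Qed.

(** Entrywise norm, submultiplicative for rectangular products. The estimates of series and
    remainders use it; the operator norm enters only through [bnd] and [opnorm]. *)
Definition nm m n (A : 'M[F]_(m, n)) : R := \sum_i \sum_j av (A i j).

Lemma nm_ge0 m n (A : 'M[F]_(m, n)) : 0 <= nm A.
Proof. by apply: sumr_ge0 => i _; apply: sumr_ge0. Qed.
Hint Resolve nm_ge0 : core.

Lemma le_nm m n (A : 'M[F]_(m, n)) i j : av (A i j) <= nm A.
Proof.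
rewrite /nm (bigD1 i) //= (bigD1 j) //= -addrA lerDl.
by rewrite addr_ge0 // !sumr_ge0 // => *; rewrite sumr_ge0.
Qed.

Lemma nm0 m n : nm (0 : 'M[F]_(m, n)) = 0.
Proof. by rewrite /nm big1 // => i _; rewrite big1 // => j _; rewrite mxE av0. Qed.

Lemma nmN m n (A : 'M[F]_(m, n)) : nm (- A) = nm A.
Proof. by apply: eq_bigr => i _; apply: eq_bigr => j _; rewrite mxE avN. Qed.

Lemma nmD m n (A B : 'M[F]_(m, n)) : nm (A + B) <= nm A + nm B.
Proof.
rewrite /nm -big_split ler_sum // => i _; rewrite -big_split ler_sum // => j _.
by rewrite mxE avD.
Qed.

Lemma nmZ m n c (A : 'M[F]_(m, n)) : nm (c *: A) = av c * nm A.
Proof.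
rewrite /nm mulr_sumr; apply: eq_bigr => i _; rewrite mulr_sumr.
by apply: eq_bigr => j _; rewrite mxE avM.
Qed.

Lemma nmM m n p (A : 'M[F]_(m, n)) (B : 'M[F]_(n, p)) : nm (A *m B) <= nm A * nm B.
Proof.
rewrite /nm mulr_suml ler_sum // => i _.
apply: (@le_trans _ _ (\sum_j \sum_k av (A i k) * av (B k j))).
  rewrite ler_sum // => j _; rewrite mxE; apply: le_trans (av_sum _ _ _) _.
  by rewrite ler_sum // => k _; rewrite avM.
rewrite exchange_big mulr_suml ler_sum // => k _ /=.
rewrite -mulr_sumr ler_wpM2l // (bigD1 k) //= lerDl.
by apply: sumr_ge0 => i' _; apply: sumr_ge0.
Qed.

Lemma nm_sum m n I (r : seq I) (P : pred I) (f : I -> 'M[F]_(m, n)) :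
  nm (\sum_(i <- r | P i) f i) <= \sum_(i <- r | P i) nm (f i).
Proof.
elim/big_ind2 : _ => //; first by rewrite nm0.
by move=> x1 x2 y1 y2 h1 h2; apply: le_trans (nmD _ _) (lerD _ _).
Qed.

Lemma nm1 n : nm (1%:M : 'M[F]_n) = n%:R.
Proof.
rewrite /nm -[n in RHS]card_ord -sumr_const; apply: eq_bigr => i _.
rewrite (bigD1 i) //= big1 ?mxE ?eqxx ?av1 ?addr0 // => j.
by rewrite eq_sym => /negbTE ji; rewrite mxE ji av0.
Qed.

(** The factor 2 is the norm of the identity, that is, the case k = 0. *)
Lemma nmX (A : 'M[F]_2) k : nm (A ^+ k) <= 2 * nm A ^+ k.
Proof.
elim: k => [|k IH]; first by rewrite !expr0 nm1 mulr1.
rewrite exprS; apply: le_trans (nmM _ _) _; rewrite exprS mulrCA.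
by rewrite ler_wpM2l.
Qed.

(** Convergence is measured by a real sequence, so that limits of matrices reduce to limits in R;
    [mcv_lim] returns to the topology behind [mexp]. *)
Definition mcv (S : nat -> 'M[F]_2) L := (fun n => nm (S n - L)) @ \oo --> (0 : R).

Lemma mcv_lim S L : mcv S L -> limn S = L.
Proof.
move=> h; apply: cvg_lim => //; apply/cvg_ballP => e e0.
(* Radii of balls live in F; a positive element of R[i] is real, which [emb_pos] abstracts. *)
have [e' ee] := emb_pos K e0.
have e'0 : 0 < e' by move: e0; rewrite ee -(rmorph0 emb) (leW_mono (ler_emb K)).
move/cvgrPdist_lt : h => /(_ _ e'0) h; near=> n.
split => // i j; rewrite /ball /= -(embE K) ee (leW_mono (ler_emb K)).
have : `|0 - nm (S n - L)| < e' by near: n.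
rewrite sub0r normrN ger0_norm //; apply: le_lt_trans.
by rewrite av_distC; move: (le_nm (S n - L) i j); rewrite !mxE.
Unshelve. all: by end_near. Qed.

Lemma mcv_le S L (u : nat -> R) : (forall n, nm (S n - L) <= u n) ->
  u @ \oo --> (0 : R) -> mcv S L.
Proof.
move=> h; apply: (squeeze_cvgr (f := fun=> 0)); last exact: cvg_cst.
by near=> n; rewrite nm_ge0 h.
Unshelve. all: by end_near. Qed.

Definition psum (A : 'M[F]_2) := series (fun k => (k`!%:R)^-1 *: A ^+ k).

(** Each entry is dominated by twice the real exponential series at [nm A], so the completeness
    field [abs_cvg] applies entry by entry. *)
Lemma psum_cvg A : mcv (psum A) (mexp A).
Proof.
suff [L h] : exists L, mcv (psum A) L by rewrite /mexp (mcv_lim h).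
have H i j : exists l, (fun n => av (psum A n i j - l)) @ \oo --> (0 : R).
  have [|l h] := @abs_cvg _ _ K (fun k => ((k`!%:R)^-1 *: A ^+ k) i j).
    apply: (@series_le_cvg _ _ (fun k => 2 * exp_coeff (nm A) k)) => //.
    - by move=> n; rewrite mulr_ge0 ?exp_coeff_ge0.
    - move=> n; rewrite mxE avM avV av_nat /exp_coeff /= mulrA mulrC.
      by rewrite ler_wpM2r ?invr_ge0 //; apply: le_trans (le_nm _ _ _) (nmX _ _).
    - exact: is_cvg_seriesZ (is_cvg_series_exp_coeff _).
  exists l; apply: cvg_trans h; apply: near_eq_cvg; near=> n.
  by rewrite /psum /series /= summxE.
have [L HL] := choice (fun ij => H ij.1 ij.2).
exists (\matrix_(i, j) L (i, j)).
rewrite /mcv (_ : (fun n => _) = fun n => \sum_i \sum_j av (psum A n i j - L (i, j))).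
  by do 2!apply: cvg_sum0 => ?; exact: HL (_, _).
by apply/funext => n; do 2!apply: eq_bigr => ? _; rewrite !mxE.
Unshelve. all: by end_near. Qed.

Lemma mcv_uniq S L L' : mcv S L -> mcv S L' -> L = L'.
Proof. by move=> /mcv_lim <- /mcv_lim <-. Qed.

Lemma mexp_uniq A L : mcv (psum A) L -> mexp A = L.
Proof. exact: mcv_uniq (psum_cvg A). Qed.

End AbsoluteValue.

#[local] Hint Extern 0 (is_true (0 <= av _ _)) => exact: av_ge0 : core.
#[local] Hint Extern 0 (is_true (0 <= nm _ _)) => exact: nm_ge0 : core.

(** * The matrix exponential *)

Section CauchyProduct.
Variables (F : numFieldType) (V : algType F).
Implicit Types x y : V.

Definition expterm x k := (k`!%:R : F)^-1 *: x ^+ k.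

Lemma expterm_addr x y k : GRing.comm x y ->
  expterm (x + y) k = \sum_(0 <= j < k.+1) expterm x (k - j) * expterm y j.
Proof.
move=> cxy; rewrite /expterm exprDn_comm // scaler_sumr big_mkord.
apply: eq_bigr => i _; rewrite -scalerAr -scalerAl scalerA -[_ *+ 'C(_, _)]scaler_nat scalerA.
congr (_ *: _); have ik : (i <= k)%N by rewrite -ltnS.
have h m : m`!%:R != 0 :> F by rewrite pnatr_eq0 -lt0n fact_gt0.
by rewrite -(bin_fact ik) !natrM; field; rewrite !h pnatr_eq0 -lt0n bin_gt0.
Qed.

Lemma triangle_sum (f : nat -> nat -> V) n :
  \sum_(0 <= k < n) \sum_(0 <= j < k.+1) f (k - j)%N j =
  \sum_(0 <= j < n) \sum_(0 <= i < n | (i + j < n)%N) f i j.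
Proof.
transitivity (\sum_(0 <= k < n) \sum_(0 <= j < n | (j < k.+1)%N) f (k - j)%N j).
  by apply: eq_big_nat => k kn; rewrite (big_nat_widen _ _ n).
rewrite (exchange_big_dep_nat predT) //=; apply: eq_big_nat => j /andP[_ jn].
transitivity (\sum_(j <= k < n) f (k - j)%N j).
  rewrite (@big_cat_nat _ _ _ j) //=; last exact: ltnW.
  rewrite big_nat_cond big_pred0 ?add0r; last first.
    by move=> k; lia.
  by rewrite big_nat_cond [RHS]big_nat_cond; apply: eq_bigl => k; rewrite ltnS; lia.
rewrite -{1}[j]add0n big_addn (big_nat_widen _ _ n) ?leq_subr //.
by apply: congr_big_nat => // i; rewrite ?ltn_subRL 1?addnC ?addnK //; lia.
Qed.

(** The square of index pairs i, j < n minus the triangle i + j < n. It is applied to the matrices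
    and to their real norms alike. *)
Lemma series_exp_mulB x y n : GRing.comm x y ->
  series (expterm x) n * series (expterm y) n - series (expterm (x + y)) n =
  \sum_(0 <= j < n) \sum_(0 <= i < n | (n <= i + j)%N) expterm x i * expterm y j.
Proof.
move=> cxy; rewrite /series /= (eq_bigr _ (fun k _ => expterm_addr k cxy)).
rewrite (triangle_sum (fun i j => expterm x i * expterm y j)) mulr_sumr -sumrB.
apply: eq_bigr => j _.
rewrite mulr_suml (bigID (fun i => i + j < n)%N) /= addrAC subrr add0r.
by apply: eq_bigl => i; rewrite -leqNgt.
Qed.

End CauchyProduct.

Lemma series_exp_le (R : realType) (x : R) n : 0 <= x -> series (exp_coeff x) n <= expR x.
Proof.
move=> x0; apply: nondecreasing_cvgn_le; last exact: is_cvg_series_exp_coeff.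
by apply/nondecreasing_seqP => k; rewrite /series /= big_nat_recr //= lerDl exp_coeff_ge0.
Qed.

Lemma exp_coeff_term (R : realType) (x : R) : exp_coeff x = expterm (x : R^o).
Proof. by apply/funext => k; rewrite /exp_coeff /expterm /= mulrC. Qed.

Section Exponential.
Variables (R : realType) (F : numFieldType) (K : rcfield R F).
Local Notation emb := (emb K).
Local Notation cj := (cj K).
Local Notation av := (av K).
Local Notation nm := (nm K).
Implicit Types A B : 'M[F]_2.

Lemma nm_expterm A k : nm (expterm A k) <= 2 * exp_coeff (nm A) k.
Proof.
rewrite nmZ avV av_nat /exp_coeff /= mulrC mulrA ler_wpM2r ?invr_ge0 //.
exact: nmX.
Qed.

Lemma cvg_exp_defect (a b : R) :
  (fun n => series (exp_coeff a) n * series (exp_coeff b) n - series (exp_coeff (a + b)) n)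
    @ \oo --> (0 : R).
Proof.
have h x := is_cvg_series_exp_coeff x : cvgn (series (exp_coeff (x : R))).
rewrite -(subrr (expR (a + b))) {1}expRD.
by apply: cvgB; [apply: cvgM|]; exact: h.
Qed.

(** The defect of the partial sums is, term by term, at most 4 times the same defect for the reals
    [nm A] and [nm B], which tends to 0 by the functional equation of [expR]; 4 is the square of the
    2 in [nm_expterm]. *)
Lemma mexpD A B : A *m B = B *m A -> mexp (A + B) = mexp A *m mexp B.
Proof.
move=> cAB; apply: (mexp_uniq (K := K)).
apply: (@mcv_le _ _ _ _ _ (fun n =>
  4 * (series (exp_coeff (nm A)) n * series (exp_coeff (nm B)) n
       - series (exp_coeff (nm A + nm B)) n) +
  ((2 * expR (nm A)) * nm (psum B n - mexp B) + nm (psum A n - mexp A) * nm (mexp B)))); last first.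
  rewrite -[X in _ --> X](addr0 0) -{1}(mulr0 4) -{2}(addr0 0).
  apply: cvgD; first by apply: cvgMr; exact: cvg_exp_defect.
  rewrite -{1}(mulr0 (2 * expR (nm A))) -{2}(mul0r (nm (mexp B))).
  by apply: cvgD; [apply: cvgMr|apply: cvgMl]; exact: psum_cvg.
move=> n.
have -> : psum (A + B) n - mexp A *m mexp B =
  - (psum A n * psum B n - psum (A + B) n) +
  (psum A n *m (psum B n - mexp B) + (psum A n - mexp A) *m mexp B).
  by rewrite mulmxBr mulmxBl opprB -[psum A n * _]/(_ *m _) !subrKA.
have hS x : nm (psum x n) <= 2 * expR (nm x).
  apply: le_trans (nm_sum _ _ _ _) _.
  apply: le_trans (ler_sum _ (fun k _ => nm_expterm x k)) _.
  by rewrite -mulr_sumr ler_wpM2l // series_exp_le.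
apply: le_trans (nmD _ _ _) (lerD _ _); last first.
  apply: le_trans (nmD _ _ _) (lerD (le_trans (nmM _ _ _) _) (nmM _ _ _)).
  by rewrite ler_wpM2r // nm_ge0.
rewrite nmN !exp_coeff_term [psum A n * _ - _](series_exp_mulB n cAB).
rewrite (@series_exp_mulB _ R^o) ?mulr_sumr; last by rewrite /GRing.comm mulrC.
apply: le_trans (nm_sum _ _ _ _) (ler_sum _ _) => j _.
rewrite mulr_sumr.
apply: le_trans (nm_sum _ _ _ _) (ler_sum _ _) => i _.
apply: le_trans (nmM _ _ _) _.
apply: le_trans (ler_pM _ _ (nm_expterm A i) (nm_expterm B j)) _; try exact: nm_ge0.
by rewrite mulrACA !exp_coeff_term -natrM lexx.
Qed.

Lemma mcv_cst_eventually (S : nat -> 'M[F]_2) L m : (forall n, S (n + m)%N = L) -> mcv K S L.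
Proof.
move=> h; rewrite /mcv -(@cvg_shiftn m).
rewrite (_ : (fun n => _) = fun=> 0); first exact: cvg_cst.
by apply/funext => n /=; rewrite h subrr nm0.
Qed.

Lemma mexp_sqr0 A : A *m A = 0 -> mexp A = 1 + A.
Proof.
move=> A2; apply: (mexp_uniq (K := K)); apply: (@mcv_cst_eventually _ _ 2) => n.
rewrite addn2 /psum /series /= !big_nat_recl //= !invr1 !scale1r addrA.
rewrite big1 ?addr0 // => i _.
by rewrite !exprS mulrA -[A * A]/(A *m A) A2 mul0r scaler0.
Qed.

Lemma mexp0 : mexp (0 : 'M[F]_2) = 1.
Proof. by rewrite mexp_sqr0 ?addr0 ?mul0mx. Qed.

Lemma mexpNK A : mexp (- A) *m mexp A = 1.
Proof. by rewrite -mexpD ?addNr ?mexp0 // mulNmx mulmxN. Qed.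

Lemma mexpKN A : mexp A *m mexp (- A) = 1.
Proof. by rewrite -{1}[A]opprK mexpNK. Qed.

Lemma mexpZD (a b : F) A : mexp ((a + b) *: A) = mexp (a *: A) *m mexp (b *: A).
Proof. by rewrite scalerDl mexpD // -!scalemxAl -!scalemxAr scalerA scalerA mulrC. Qed.

Lemma psum_conj (V W A : 'M[F]_2) n : W *m V = 1 ->
  psum (V *m A *m W) n = V *m psum A n *m W.
Proof.
move=> WV; rewrite /psum /series /= mulmx_sumr mulmx_suml.
apply: eq_bigr => k _; rewrite -scalemxAr -scalemxAl; congr (_ *: _).
elim: k => [|k IH]; first by rewrite !expr0 mulmx1 (mulmx1C WV).
by rewrite !exprS IH -[_ * _]/(_ *m _) !mulmxA -(mulmxA _ W) WV mulmx1.
Qed.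

Lemma mexp_conj (V W A : 'M[F]_2) : W *m V = 1 -> mexp (V *m A *m W) = V *m mexp A *m W.
Proof.
move=> WV; apply: (mexp_uniq (K := K)).
apply: (@mcv_le _ _ _ _ _ (fun n => (nm V * nm W) * nm (psum A n - mexp A))).
  move=> n; rewrite psum_conj // -mulmxBl -mulmxBr.
  apply: le_trans (nmM _ _ _) _; rewrite mulrAC ler_wpM2r ?nmM ?nm_ge0 //.
by rewrite -(mulr0 (nm V * nm W)); apply: cvgMr; exact: psum_cvg.
Qed.

Lemma psum_comm A B n : A *m B = B *m A -> A *m psum B n = psum B n *m A.
Proof.
move=> cAB; rewrite /psum /series /= mulmx_sumr mulmx_suml; apply: eq_bigr => k _.
by rewrite -scalemxAr -scalemxAl; congr (_ *: _); exact: (commrX k cAB).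
Qed.

Lemma mexp_comm A B : A *m B = B *m A -> A *m mexp B = mexp B *m A.
Proof.
move=> cAB; apply: (@mcv_uniq _ _ K (fun n => A *m psum B n)).
  apply: (@mcv_le _ _ _ _ _ (fun n => nm A * nm (psum B n - mexp B))).
    by move=> n; rewrite -mulmxBr nmM.
  by rewrite -(mulr0 (nm A)); apply: cvgMr; exact: psum_cvg.
apply: (@mcv_le _ _ _ _ _ (fun n => nm (psum B n - mexp B) * nm A)).
  by move=> n; rewrite psum_comm // -mulmxBl nmM.
by rewrite -(mul0r (nm A)); apply: cvgMl; exact: psum_cvg.
Qed.

Lemma mcv_bound (S : nat -> 'M[F]_2) L B C m :
  mcv K S L -> (forall n, nm (S (n + m)%N - B) <= C) -> nm (L - B) <= C.
Proof.
rewrite /mcv -(@cvg_shiftn m) => h hC; apply/ler_addgt0Pl => e e0.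
move/cvgrPdist_lt : h => /(_ _ e0) [n _ /(_ n (leqnn n))] /=.
rewrite sub0r normrN ger0_norm // => h.
rewrite -(subrKA (S (n + m)%N)); apply: le_trans (nmD _ _ _) (lerD _ _) => //.
by rewrite -nmN opprB ltW.
Qed.

(** Each term of order k >= 2 carries |d| ^ k <= d ^ 2, and what remains is bounded by the
    exponential series at [nm A]. *)
Lemma mexp_taylor A (d : R) : `|d| <= 1 ->
  nm (mexp (emb d *: A) - (1 + emb d *: A)) <= 2 * expR (nm A) * d ^+ 2.
Proof.
move=> d1; apply: (mcv_bound (m := 2) (psum_cvg K _)) => n.
rewrite addn2 /psum /series /= big_ltn // big_ltn // !invr1 !scale1r expr0 expr1.
rewrite addrA [_ - _]addrAC subrr add0r.
apply: le_trans (nm_sum _ _ _ _) _.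
apply: (@le_trans _ _ (\sum_(2 <= k < n.+2) 2 * d ^+ 2 * exp_coeff (nm A) k)).
  rewrite big_nat_cond [leRHS]big_nat_cond ler_sum // => k /andP[/andP[k2 _] _].
  apply: le_trans (nm_expterm _ _) _; rewrite -mulrA ler_wpM2l // nmZ av_emb.
  rewrite /exp_coeff /= exprMn -mulrA ler_wpM2r ?divr_ge0 ?exprn_ge0 //.
  by rewrite -[d ^+ 2]real_normK ?num_real // ler_wiXn2l.
rewrite -mulr_sumr [leLHS]mulrAC ler_wpM2r ?sqr_ge0 // ler_wpM2l //.
apply: le_trans (series_exp_le n.+2 (nm_ge0 K A)).
rewrite /series /= [leRHS]big_ltn // [in leRHS]big_ltn // addrA lerDr.
by rewrite addr_ge0 // exp_coeff_ge0.
Qed.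

End Exponential.

(** * Products of exponentials of bounded cost *)

Lemma ord2P (P : 'I_2 -> Prop) : P 0 -> P 1 -> forall i, P i.
Proof.
move=> P0 P1 [[|[|//]] h]; [move: P0|move: P1]; congr P; exact: val_inj.
Qed.

Lemma sum2 (V : nmodType) (f : 'I_2 -> V) : \sum_i f i = f 0 + f 1.
Proof. by rewrite !big_ord_recl big_ord0 addr0; congr (_ + f _); exact: val_inj. Qed.

Lemma mx22E (T : pzSemiRingType) (a b c d : T) : let A := mx22 a b c d in
  (A 0 0 = a) * (A 0 1 = b) * (A 1 0 = c) * (A 1 1 = d).
Proof. by rewrite /mx22 !mxE. Qed.

Lemma mx22_eta (T : pzSemiRingType) (A : 'M[T]_2) : A = mx22 (A 0 0) (A 0 1) (A 1 0) (A 1 1).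
Proof. by apply/matrixP; apply: ord2P; apply: ord2P; rewrite mx22E. Qed.

Lemma mul_mx22 (T : pzSemiRingType) (a b c d a' b' c' d' : T) :
  mx22 a b c d *m mx22 a' b' c' d' =
  mx22 (a * a' + b * c') (a * b' + b * d') (c * a' + d * c') (c * b' + d * d').
Proof. by apply/matrixP; apply: ord2P; apply: ord2P; rewrite [LHS]mxE sum2 !mx22E. Qed.

Lemma mx22_1 (T : pzSemiRingType) : mx22 1 0 0 1 = 1%:M :> 'M[T]_2.
Proof. by apply/matrixP; apply: ord2P; apply: ord2P; rewrite [RHS]mxE mx22E. Qed.

Lemma add_mx22 (T : pzSemiRingType) (a b c d a' b' c' d' : T) :
  mx22 a b c d + mx22 a' b' c' d' = mx22 (a + a') (b + b') (c + c') (d + d').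
Proof. by apply/matrixP; apply: ord2P; apply: ord2P; rewrite [LHS]mxE !mx22E. Qed.

Section Reach.
Variables (R : realType) (F : numFieldType) (K : rcfield R F).
Local Notation emb := (emb K).
Local Notation cj := (cj K).
Local Notation av := (av K).
Local Notation nm := (nm K).
Implicit Types (A B G : 'M[F]_2) (v : 'cV[F]_2).

Definition vn (v : 'cV[F]_2) : R := Num.sqrt (\sum_(i < 2) av (v i 0) ^+ 2).

Definition bnd A (c : R) := forall v, vn (A *m v) <= c * vn v.

(** Costs are bounds in the sense of [bnd] rather than norms, so a factor may be charged more than
    its norm; [reach_magnus] turns such a product into an upper bound for the Magnus exponent. *)
Inductive reach : 'M[F]_2 -> R -> Prop :=
| reach_exp A c : bnd A c -> reach (mexp A) c
| reach_mul G H c d : reach G c -> reach H d -> reach (G *m H) (c + d).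

Lemma vn_ge0 v : 0 <= vn v.
Proof. exact: sqrtr_ge0. Qed.

Lemma vn_sqr v : vn v ^+ 2 = av (v 0 0) ^+ 2 + av (v 1 0) ^+ 2.
Proof. by rewrite sqr_sqrtr ?sum2 // addr_ge0 // sqr_ge0. Qed.

Lemma le_vn v i : av (v i 0) <= vn v.
Proof.
rewrite -(@ler_pXn2r _ 2) ?nnegrE ?vn_ge0 // vn_sqr.
by elim/ord2P : i; rewrite ?lerDl ?lerDr sqr_ge0.
Qed.

Lemma vn_le_sum v : vn v <= av (v 0 0) + av (v 1 0).
Proof.
rewrite -(@ler_pXn2r _ 2) ?nnegrE ?vn_ge0 ?addr_ge0 // vn_sqr sqrrD lerD2r lerDl.
by rewrite mulrn_wge0 // mulr_ge0.
Qed.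

Lemma vnZ k v : vn (k *: v) = av k * vn v.
Proof.
apply: (pexpIrn (n := 2)) => //; rewrite ?nnegrE ?mulr_ge0 ?vn_ge0 //.
by rewrite exprMn !vn_sqr !mxE !avM !exprMn mulrDr.
Qed.

Lemma bnd_nm A : bnd A (nm A).
Proof.
move=> v; apply: le_trans (vn_le_sum _) _.
rewrite /nm sum2 mulrDl; apply: lerD; rewrite mxE;
  (apply: le_trans (av_sum _ _ _ _) _); rewrite mulr_suml;
  apply: ler_sum => j _; by rewrite avM ler_wpM2l // le_vn.
Qed.

Lemma bndZ A c (d : R) : bnd A c -> bnd (emb d *: A) (`|d| * c).
Proof. by move=> h v; rewrite -scalemxAl vnZ av_emb -mulrA ler_wpM2l. Qed.

Lemma bnd_le A c d : bnd A c -> c <= d -> bnd A d.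
Proof. by move=> h cd v; apply: le_trans (h v) _; rewrite ler_wpM2r // vn_ge0. Qed.

Lemma reach_le G c d : reach G c -> c <= d -> reach G d.
Proof.
move=> rG; elim: G c / rG d => [A c h|G H c e rG _ rH IH] d cd; first exact/reach_exp/(bnd_le h).
have -> : d = c + (d - c) by rewrite subrKC.
by apply: reach_mul => //; apply: IH; rewrite lerBrDl.
Qed.

Lemma mexp_diag z1 z2 d1 d2 :
  (fun n => av (series (fun k => (k`!%:R)^-1 * z1 ^+ k) n - d1)) @ \oo --> (0 : R) ->
  (fun n => av (series (fun k => (k`!%:R)^-1 * z2 ^+ k) n - d2)) @ \oo --> (0 : R) ->
  mexp (mx22 z1 0 0 z2) = mx22 d1 0 0 d2.
Proof.
move=> h1 h2; apply: (mexp_uniq (K := K)).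
have hX k : mx22 z1 0 0 z2 ^+ k = mx22 (z1 ^+ k) 0 0 (z2 ^+ k).
  elim: k => [|k IH]; first by rewrite !expr0 mx22_1.
  by rewrite !exprS IH -[LHS]/(_ *m _) mul_mx22 !(mulr0, mul0r, addr0, add0r).
apply: (@mcv_le _ _ _ _ _ (fun n => av (series (fun k => (k`!%:R)^-1 * z1 ^+ k) n - d1)
    + av (series (fun k => (k`!%:R)^-1 * z2 ^+ k) n - d2))); last first.
  by rewrite -[X in _ --> X]addr0; exact: cvgD.
move=> n; rewrite /nm !sum2.
have e i j : psum (mx22 z1 0 0 z2) n i j =
  mx22 (series (fun k => (k`!%:R)^-1 * z1 ^+ k) n) 0 0
       (series (fun k => (k`!%:R)^-1 * z2 ^+ k) n) i j.
  rewrite /psum /series /= summxE; elim/ord2P : i; elim/ord2P : j; rewrite mx22E;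
    do ?[by apply: eq_bigr => k _; rewrite mxE hX mx22E
        |by rewrite big1 // => k _; rewrite mxE hX mx22E mulr0].
by rewrite !mxE !e !mx22E subrr av0 addr0 add0r.
Qed.

Lemma nm_mx22 a b c d : nm (mx22 a b c d) = av a + av b + (av c + av d).
Proof. by rewrite /nm !sum2 !mx22E. Qed.

(** Each diagonal entry splits into two factors by [exp_near1], hence two diagonal exponentials,
    each of entrywise norm at most 4 e + 4 e. *)
Lemma reach_diag x y e : av (x - 1) <= e -> av (y - 1) <= e -> e <= 2^-1 ->
  reach (mx22 x 0 0 y) (16 * e).
Proof.
move=> hx hy he.
have [z1 [z2 [x1 [x2 [dx hz1 hz2 c1 c2]]]]] := exp_near1 (le_trans hx he).
have [t1 [t2 [y1 [y2 [dy ht1 ht2 k1 k2]]]]] := exp_near1 (le_trans hy he).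
subst x y; have -> : mx22 (x1 * x2) 0 0 (y1 * y2) = mx22 x1 0 0 y1 *m mx22 x2 0 0 y2.
  by rewrite mul_mx22 !(mulr0, mul0r, addr0, add0r).
have -> : 16 * e = 8 * e + 8 * e by lra.
rewrite -(mexp_diag c1 k1) -(mexp_diag c2 k2).
apply: reach_mul; apply: reach_exp; apply: bnd_le (@bnd_nm _) _;
  rewrite nm_mx22 av0; lra.
Qed.

(* Gauss elimination: unipotent factors are exponentials of nilpotent matrices. *)
Lemma reach_near1 G : nm (G - 1) <= 8^-1 -> reach G (36 * nm (G - 1)).
Proof.
set e := nm _ => he.
rewrite (mx22_eta G); set a := G 0 0; set b := G 0 1; set c := G 1 0; set d := G 1 1.
have [ha hb hc hd] : [/\ av (a - 1) <= e, av b <= e, av c <= e & av (d - 1) <= e].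
  have h := le_nm K (G - 1).
  by split; [have := h 0 0|have := h 0 1|have := h 1 0|have := h 1 1];
    rewrite !mxE ?subr0.
have e0 : 0 <= e by apply: nm_ge0.
have a2 : 2^-1 <= av a.
  have : av 1 <= av a + av (a - 1).
    by rewrite [av (a - 1)]av_distC -[X in av X <= _](subrKC a); exact: avD.
  by rewrite av1; lra.
have a0 : a != 0 by rewrite -(av_eq0 K) gt_eqF //; lra.
have ia : av a^-1 <= 2 by rewrite avV -[2]invrK lef_pV2 // posrE; lra.
have -> : mx22 a b c d = mexp (mx22 0 0 (c / a) 0) *m
    (mx22 a 0 0 (d - c * b / a) *m mexp (mx22 0 (b / a) 0 0)).
  rewrite !(mexp_sqr0 K) ?mul_mx22 ?(mulr0, mul0r, addr0) //; last 2 first.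
  - by apply/matrixP; apply: ord2P; apply: ord2P; rewrite mx22E mxE.
  - by apply/matrixP; apply: ord2P; apply: ord2P; rewrite mx22E mxE.
  rewrite -[1]/(1%:M) -mx22_1 !add_mx22 !mul_mx22.
  by congr mx22; field.
have hdiv x : av x <= e -> av (x / a) <= 2 * e.
  by move=> hx; rewrite avM mulrC; apply: ler_pM.
(* The unipotent factors cost 2 e each because |1 / a| <= 2. The pivot d - c b / a is within e + 2 e
   ^ 2 <= 2 e of 1, so the diagonal factor costs 16 (2 e). *)
have -> : 36 * e = 2 * e + (16 * (2 * e) + 2 * e) by lra.
apply: reach_mul; first by apply: reach_exp; apply: bnd_le (@bnd_nm _) _;
  rewrite nm_mx22 !av0 !add0r addr0; apply: hdiv.
apply: reach_mul; last by apply: reach_exp; apply: bnd_le (@bnd_nm _) _;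
  rewrite nm_mx22 !av0 add0r !addr0; apply: hdiv.
apply: reach_diag; [lra| |lra].
rewrite addrAC; apply: le_trans (avB _ _ _) _.
have : av (c * b / a) <= e * (2 * e) by rewrite -mulrA avM ler_pM // hdiv.
have : e * (2 * e) <= e * 1 by rewrite ler_wpM2l //; lra.
lra.
Qed.

End Reach.

#[local] Hint Extern 0 (is_true (0 <= vn _ _)) => exact: vn_ge0 : core.

(** * First-order expansions *)

Section FirstOrder.
Variables (R : realType) (F : numFieldType) (K : rcfield R F).
Local Notation emb := (emb K).
Local Notation cj := (cj K).
Local Notation av := (av K).
Local Notation nm := (nm K).
Implicit Types A B G P Q T W : 'M[F]_2.

(** The remainder is quadratic on the fixed interval |s| <= 1, so no neighbourhood has to be tracked
    through sums and products, and remainders convert directly into costs of order s ^ 2. *)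
Definition expands (f : R -> F) (f0 f1 : F) := exists2 C : R, 0 <= C &
  forall s : R, `|s| <= 1 -> av (f s - (f0 + emb s * f1)) <= C * s ^+ 2.

Lemma expands_cst c : expands (fun=> c) c 0.
Proof.
by exists 0 => // s _; rewrite mulr0 addr0 subrr av0 mul0r.
Qed.

Lemma expandsD f f0 f1 g g0 g1 : expands f f0 f1 -> expands g g0 g1 ->
  expands (fun s => f s + g s) (f0 + g0) (f1 + g1).
Proof.
move=> [C C0 hf] [D D0 hg]; exists (C + D); first exact: addr_ge0.
move=> s s1; rewrite (_ : _ - _ = (f s - (f0 + emb s * f1)) + (g s - (g0 + emb s * g1))).
  by rewrite mulrDl; apply: le_trans (avD _ _ _) (lerD (hf _ s1) (hg _ s1)).
ring.
Qed.

Lemma expandsN f f0 f1 : expands f f0 f1 -> expands (fun s => - f s) (- f0) (- f1).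
Proof.
move=> [C C0 hf]; exists C => // s s1.
by rewrite mulrN -opprD -opprD avN; exact: hf.
Qed.

Lemma expands_cj f f0 f1 : expands f f0 f1 -> expands (fun s => cj (f s)) (cj f0) (cj f1).
Proof.
move=> [C C0 hf]; exists C => // s s1.
by rewrite -[emb s](cj_emb K) -rmorphM -rmorphD -rmorphB av_cj; exact: hf.
Qed.

Lemma expandsM f f0 f1 g g0 g1 : expands f f0 f1 -> expands g g0 g1 ->
  expands (fun s => f s * g s) (f0 * g0) (f0 * g1 + f1 * g0).
Proof.
move=> [C C0 hf] [D D0 hg].
exists (av f1 * av g1 + (C * (D + (av g0 + av g1)) + (av f0 + av f1) * D)).
  by rewrite !(addr_ge0, mulr_ge0).
move=> s s1; have {}hf := hf _ s1; have {}hg := hg _ s1.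
set ph := f s - _ in hf; set ga := g s - _ in hg.
have s2 : s ^+ 2 <= 1 by rewrite -real_normK ?num_real // expr_le1.
have lin x y : av (x + emb s * y) <= av x + av y.
  by apply: le_trans (avD _ _ _) (lerD _ _); rewrite // avM av_emb ler_piMl.
have hg' : av (g s) <= D + (av g0 + av g1).
  rewrite -[g s](subrK (g0 + emb s * g1)); apply: le_trans (avD _ _ _) (lerD _ (lin _ _)).
  by apply: le_trans hg _; rewrite ler_piMr.
have -> : f s * g s - (f0 * g0 + emb s * (f0 * g1 + f1 * g0)) =
    emb s ^+ 2 * (f1 * g1) + (ph * g s + (f0 + emb s * f1) * ga).
  by rewrite /ph /ga; ring.
have s20 : 0 <= s ^+ 2 by apply: sqr_ge0.
apply: le_trans (avD _ _ _) _; rewrite [leRHS]mulrDl; apply: lerD.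
  by rewrite -rmorphXn !avM av_emb ger0_norm // mulrC.
apply: le_trans (avD _ _ _) _; rewrite [leRHS]mulrDl; apply: lerD; rewrite avM.
  by rewrite mulrAC; apply: ler_pM.
by rewrite -mulrA; apply: ler_pM.
Qed.

(** Near 0 the linear term s f1 dominates the remainder C s ^ 2. *)
Lemma expands_neq0 f f1 : expands f 0 f1 -> f1 != 0 ->
  exists2 s0 : R, 0 < s0 & forall s : R, s != 0 -> `|s| <= s0 -> f s != 0.
Proof.
move=> [C C0 hf] f10; have a0 : 0 < av f1 by rewrite lt_def av_eq0 f10 /=.
exists (Num.min 1 (av f1 / (C + 1) / 2)).
  by rewrite lt_min ltr01 !divr_gt0 // ltr_wpDl.
move=> s sn0; rewrite le_min => /andP[s1 s2]; apply/eqP => fs0.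
have := hf s s1; rewrite fs0 sub0r add0r avN avM av_emb.
rewrite -[s ^+ 2]real_normK ?num_real // expr2 mulrA [leLHS]mulrC.
have sp : 0 < `|s| by rewrite normr_gt0.
rewrite ler_pM2r // => h.
have : (C + 1) * `|s| <= av f1 / 2.
  move: s2; rewrite mulrAC ler_pdivlMr ?ltr_wpDl //; lra.
have := C0; nra.
Qed.

Definition mexpands (f : R -> 'M[F]_2) P :=
  forall i j, expands (fun s => f s i j) ((1%:M : 'M[F]_2) i j) (P i j).

Lemma mexpands_exp A : mexpands (fun s => mexp (emb s *: A)) A.
Proof.
move=> i j; exists (2 * expR (nm A)); first by rewrite mulr_ge0 ?expR_ge0.
move=> s s1; apply: le_trans (mexp_taylor K A s1).
apply: le_trans (le_nm K _ i j); rewrite le_eqVlt; apply/orP; left; apply/eqP.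
have e M : (M - (1%:M + emb s *: A)) i j = M i j - ((1%:M : 'M[F]_2) i j + emb s * A i j).
  by rewrite !mxE.
by congr av; exact/esym/e.
Qed.

Lemma mexpandsM f g P Q : mexpands f P -> mexpands g Q ->
  mexpands (fun s => f s *m g s) (P + Q).
Proof.
move=> hf hg i j.
have h := expandsD (expandsM (hf i 0) (hg 0 j)) (expandsM (hf i 1) (hg 1 j)).
have -> : (fun s => (f s *m g s) i j) = (fun s => f s i 0 * g s 0 j + f s i 1 * g s 1 j).
  by apply/funext => s; rewrite mxE sum2.
have := congr1 (fun M : 'M[F]_2 => M i j) (mulmx1 (1%:M : 'M[F]_2)).
have := congr1 (fun M : 'M[F]_2 => M i j) (mul1mx Q).
have := congr1 (fun M : 'M[F]_2 => M i j) (mulmx1 P).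
rewrite /= ![(_ *m _) _ _]mxE !sum2 => e1 e2 e3; rewrite [(P + Q) i j]mxE.
by move: h; rewrite e3 addrACA e2 e1 [Q i j + _]addrC.
Qed.

Lemma mexpands_near1 f : mexpands f 0 -> exists2 C : R, 0 <= C &
  forall s : R, `|s| <= 1 -> nm (f s - 1) <= C * s ^+ 2.
Proof.
move=> h; have [C1 C10 h1] := h 0 0; have [C2 C20 h2] := h 0 1.
have [C3 C30 h3] := h 1 0; have [C4 C40 h4] := h 1 1.
exists (C1 + C2 + (C3 + C4)); first by rewrite !addr_ge0.
move=> s s1; rewrite /nm !sum2 !mulrDl.
move: (h1 _ s1) (h2 _ s1) (h3 _ s1) (h4 _ s1); rewrite !mxE !mulr0 !addr0 => *.
by do !apply: lerD.
Qed.

(** Dividing the product by exp (d (P + T + Q)) cancels the first-order terms. The quotient [G] is 1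
    + O(d ^ 2), and [reach_near1] realizes it exactly at a cost that the slack (c' - c) d
    absorbs. *)
Lemma reach_product P T Q (c c' : R) : bnd K (P + T + Q) c -> c < c' ->
  exists2 d0 : R, 0 < d0 & forall d : R, 0 < d -> d <= d0 ->
    reach K (mexp (emb d *: P) *m mexp (emb d *: T) *m mexp (emb d *: Q)) (c' * d).
Proof.
move=> hW cc'; set W := P + T + Q in hW.
have := mexpandsM (mexpandsM (mexpandsM (mexpands_exp P) (mexpands_exp T))
  (mexpands_exp Q)) (mexpands_exp (- W)).
rewrite subrr => /mexpands_near1 [C C0 hC].
(* The three thresholds serve, in order, the expansion, the hypothesis of [reach_near1], and the
   inequality 36 C d ^ 2 <= (c' - c) d. *)
exists (Num.min 1 (Num.min (8^-1 / (C + 1)) ((c' - c) / (36 * C + 1)))).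
  rewrite !lt_min ltr01 !divr_gt0 ?subr_gt0 //=; lra.
move=> d dp; rewrite !le_min => /and3P[d1 d2 d3].
have dn : `|d| <= 1 by rewrite ger0_norm // ltW.
have {hC} := hC _ dn; rewrite scalerN.
set M := _ *m mexp (_ *: Q); set G := M *m _ => hG.
have -> : M = G *m mexp (emb d *: W) by rewrite /G -mulmxA (mexpNK K) mulmx1.
have h2 : C * d ^+ 2 <= C * d by rewrite ler_wpM2l // expr2 ler_piMr // ltW.
have h3 : (C + 1) * d <= 8^-1 by move: d2; rewrite ler_pdivlMr; lra.
have h4 : d * (36 * C + 1) <= c' - c by move: d3; rewrite ler_pdivlMr; lra.
have G8 : nm (G - 1) <= 8^-1 by lra.
apply: (reach_le (c := 36 * nm (G - 1) + `|d| * c)).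
  by apply: reach_mul; [exact: reach_near1|exact/reach_exp/bndZ].
rewrite ger0_norm ?(ltW dp) //.
have : d * (36 * C * d) <= d * (c' - c) by rewrite ler_pM2l //; lra.
lra.
Qed.

(** Lagrange's identity: Cauchy-Schwarz together with its defect, the squared modulus of a
    determinant. The inequality bounds rank one matrices; the defect produces the strict gain. *)
Lemma lagrange a b x y : (av a ^+ 2 + av b ^+ 2) * (av x ^+ 2 + av y ^+ 2) =
  av (a * x + b * y) ^+ 2 + av (a * cj y - b * cj x) ^+ 2.
Proof.
apply: (@emb_inj _ _ K); rewrite rmorphM !rmorphD /= -!mul_cj.
by rewrite !(rmorphM, rmorphD, rmorphN) /= !cjK; ring.
Qed.

End FirstOrder.

(** * The shortening construction *)

(** The number c is the midpoint of 2 N - k, the first-order norm, and 2 N - 1, the break-even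
    value. Then c ^ 2 - al grows at least like N and c ^ 2 - ga like N ^ 2, so their product beats
    be ^ 2, which is of order N ^ 2. *)
Lemma large_parameter (R : realType) (k e C : R) : 1 < k -> 0 < e -> 0 <= C ->
  exists N : R, [/\ 0 < N, 0 <= 2 * N - (1 + k) / 2 & forall al ga be : R, 0 <= be ->
    al <= 4 * N ^+ 2 - 4 * N * k + C -> ga <= N ^+ 2 * (4 - e) + N * C + C ->
    be <= C * N + C -> let c := 2 * N - (1 + k) / 2 in
    [/\ 0 <= c ^+ 2 - al, 0 <= c ^+ 2 - ga & be ^+ 2 <= (c ^+ 2 - al) * (c ^+ 2 - ga)]].
Proof.
move=> k1 e0 C0; pose h := (k - 1) / 2; have h0 : 0 < h by rewrite /h; lra.
pose u1 := C / h; pose u2 := (8 * k + 4 * C) / e; pose u3 := 4 * C ^+ 2 / (h * e).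
have he0 : 0 < h * e by apply: mulr_gt0.
have C20 : 0 <= C ^+ 2 by apply: sqr_ge0.
have u10 : 0 <= u1 by rewrite divr_ge0 // ltW.
have u20 : 0 <= u2 by rewrite divr_ge0 //; lra.
have u30 : 0 <= u3 by rewrite divr_ge0 ?(ltW he0) //; lra.
(* A sum of nonnegative thresholds stands for their maximum; each of [N1], [N2], [N3] reads off one
   of them. *)
pose N := 1 + k + u1 + u2 + u3.
have N1 : C <= N * h by rewrite -ler_pdivrMr // -/u1 /N; lra.
have N2 : 8 * k + 4 * C <= N * e by rewrite -ler_pdivrMr // -/u2 /N; lra.
have N3 : 4 * C ^+ 2 <= N * (h * e) by rewrite -ler_pdivrMr // -/u3 /N; lra.
have Nk : 1 + k <= N by rewrite /N; lra.
clearbody N; clear u1 u2 u3 u10 u20 u30.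
have N0 : 0 < N by lra.
exists N; split => //; first by lra.
move=> al ga be be0 hal hga hbe c.
have hp : 2 * (N * h) <= c ^+ 2 - al.
  have : 0 <= ((1 + k) / 2) ^+ 2 by apply: sqr_ge0.
  have -> : c ^+ 2 = 4 * N ^+ 2 - 2 * N * (1 + k) + ((1 + k) / 2) ^+ 2 by rewrite /c; field.
  have : N * h = (N * k - N) / 2 by rewrite /h; field.
  lra.
have hq : N * (N * e) / 2 <= c ^+ 2 - ga.
  have : 0 <= ((1 + k) / 2) ^+ 2 by apply: sqr_ge0.
  have -> : c ^+ 2 = 4 * N ^+ 2 - 2 * N * (1 + k) + ((1 + k) / 2) ^+ 2 by rewrite /c; field.
  have : N * (8 * k + 4 * C) <= N * (N * e) by rewrite ler_pM2l.
  have : N * 1 <= N * k by rewrite ler_pM2l //; lra.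
  have : 1 * C <= N * C by rewrite ler_wpM2r //; lra.
  rewrite [N ^+ 2]expr2; lra.
have p0 : 0 <= N * h by rewrite mulr_ge0 // ltW.
have q0 : 0 <= N * (N * e) / 2 by rewrite divr_ge0 // !mulr_ge0 // ltW.
split; [lra|lra|].
apply: (@le_trans _ _ (2 * (N * h) * (N * (N * e) / 2))); last by rewrite ler_pM //; lra.
apply: (@le_trans _ _ ((2 * C * N) ^+ 2)).
  have : 1 * C <= C * N by rewrite mulrC ler_wpM2l //; lra.
  by move=> ?; rewrite ler_pXn2r ?nnegrE ?mulr_ge0 ?(ltW N0) //; lra.
have -> : (2 * C * N) ^+ 2 = N ^+ 2 * (4 * C ^+ 2) by ring.
have -> : 2 * (N * h) * (N * (N * e) / 2) = N ^+ 2 * (N * (h * e)) by field.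
by rewrite ler_wpM2l // sqr_ge0.
Qed.

Section Shortening.
Variables (R : realType) (F : numFieldType) (K : rcfield R F).
Local Notation emb := (emb K).
Local Notation cj := (cj K).
Local Notation av := (av K).
Local Notation nm := (nm K).
Local Notation vn := (vn K).
Local Notation bnd := (bnd K).
Local Notation reach := (reach K).
Implicit Types X Y Z : 'M[F]_2.

(** X^* X = 1 written out in entries, in a form suited to rewriting and [ring]; [orthocolsP] gives
    the matrix form. *)
Definition orthocols X :=
  [/\ X 0 0 * cj (X 0 0) + X 1 0 * cj (X 1 0) = 1,
      X 0 1 * cj (X 0 1) + X 1 1 * cj (X 1 1) = 1
    & X 0 0 * cj (X 0 1) + X 1 0 * cj (X 1 1) = 0].

Lemma emb_av2 x : emb (av x) ^+ 2 = x * cj x.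
Proof. by rewrite mul_cj rmorphXn. Qed.

Lemma mul_mxE m n (A : 'M[F]_(m, 2)) (B : 'M[F]_(2, n)) i j :
  (A *m B) i j = A i 0 * B 0 j + A i 1 * B 1 j.
Proof. by rewrite mxE sum2. Qed.

Lemma orthocols_cj X : orthocols X -> cj (X 0 0) * X 0 1 + cj (X 1 0) * X 1 1 = 0.
Proof.
by move=> [_ _ /(congr1 cj)]; rewrite rmorphD /= !rmorphM /= !cjK rmorph0.
Qed.

Lemma vn_iso X v : orthocols X -> vn (X *m v) = vn v.
Proof.
move=> hX; have h3' := orthocols_cj hX; case: hX => h1 h2 h3.
apply: (pexpIrn (n := 2)) => //; rewrite ?nnegrE // !vn_sqr.
apply: (@emb_inj _ _ K); rewrite !rmorphD /= -!mul_cj !mul_mxE !rmorphD /= !rmorphM /=.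
set x := v 0 0; set y := v 1 0.
transitivity (x * cj x * (X 0 0 * cj (X 0 0) + X 1 0 * cj (X 1 0))
  + y * cj y * (X 0 1 * cj (X 0 1) + X 1 1 * cj (X 1 1))
  + x * cj y * (X 0 0 * cj (X 0 1) + X 1 0 * cj (X 1 1))
  + y * cj x * (cj (X 0 0) * X 0 1 + cj (X 1 0) * X 1 1)); first by ring.
by rewrite h1 h2 h3 h3' !mulr1 !mulr0 !addr0.
Qed.

Lemma bnd_iso X : orthocols X -> bnd X 1.
Proof. by move=> hX v; rewrite vn_iso // mul1r. Qed.

(** This is r p^* / (|r| |p|), and Cauchy-Schwarz bounds |p^* v| by |p| |v|. *)
Lemma bnd_rank1 r0 r1 p0 p1 (n1 n2 : R) : 0 < n1 -> 0 < n2 ->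
  n1 ^+ 2 = av r0 ^+ 2 + av r1 ^+ 2 -> n2 ^+ 2 = av p0 ^+ 2 + av p1 ^+ 2 ->
  bnd (emb (n1 * n2)^-1 *: mx22 (r0 * cj p0) (r0 * cj p1) (r1 * cj p0) (r1 * cj p1)) 1.
Proof.
move=> n10 n20 e1 e2 v; rewrite mul1r -(@ler_pXn2r _ 2) ?nnegrE //.
rewrite -scalemxAl vnZ exprMn av_emb real_normK ?num_real //.
rewrite vn_sqr !mul_mxE !mx22E -!mulrA -!mulrDr !avM !exprMn -mulrDl -e1 vn_sqr.
have := lagrange K (cj p0) (cj p1) (v 0 0) (v 1 0).
rewrite !av_cj -e2; set s := _ + _ * v 1 0; set t := _ - _ => e.
have -> : (n1 * n2)^-1 * ((n1 * n2)^-1 * (n1 ^+ 2 * av s ^+ 2)) = av s ^+ 2 / n2 ^+ 2.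
  by field; rewrite !gt_eqF.
by rewrite ler_pdivrMr ?exprn_gt0 // mulrC e lerDl sqr_ge0.
Qed.

(** Positivity of the Hermitian matrix c ^ 2 - M^* M, tested by its diagonal and its determinant: al
    and ga are the diagonal entries of M^* M and be is the modulus of the off-diagonal one. *)
Lemma bnd_cols (M : 'M[F]_2) (c : R) : 0 <= c ->
  let al := av (M 0 0) ^+ 2 + av (M 1 0) ^+ 2 in
  let ga := av (M 0 1) ^+ 2 + av (M 1 1) ^+ 2 in
  let be := av (cj (M 0 0) * M 0 1 + cj (M 1 0) * M 1 1) in
  0 <= c ^+ 2 - al -> 0 <= c ^+ 2 - ga -> be ^+ 2 <= (c ^+ 2 - al) * (c ^+ 2 - ga) ->
  bnd M c.
Proof.
move=> c0 al ga be; set p := c ^+ 2 - al; set q := c ^+ 2 - ga => p0 q0 bpq v.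
have be0 : 0 <= be by exact: av_ge0.
rewrite -(@ler_pXn2r _ 2) ?nnegrE ?mulr_ge0 // exprMn !vn_sqr !mul_mxE.
set x := v 0 0; set y := v 1 0.
set L := (X in X <= _).
pose t := (cj (M 0 0) * M 0 1 + cj (M 1 0) * M 1 1) * (y * cj x).
have eL : L - (al * av x ^+ 2 + ga * av y ^+ 2) <= 2 * (be * (av y * av x)).
  apply: le_trans (ler_norm _) _.
  rewrite -(av_emb K) (_ : emb _ = t + cj t).
    by apply: le_trans (avD _ _ _) _; rewrite av_cj /t !avM av_cj /be; lra.
  rewrite /L /al /ga /t !(rmorphXn, rmorphB, rmorphD, rmorphM) /= !emb_av2.
  by rewrite !(rmorphD, rmorphM) /= !cjK; ring.
have h : be * (av y * av x) * 2 <= p * av x ^+ 2 + q * av y ^+ 2.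
  have x20 := sqr_ge0 (av x); have y20 := sqr_ge0 (av y).
  rewrite -(@ler_pXn2r _ 2) ?nnegrE ?addr_ge0 ?mulr_ge0 ?sqr_ge0 //.
  apply: (@le_trans _ _ (4 * (p * q) * (av x ^+ 2 * av y ^+ 2))).
    rewrite (_ : (_ * 2) ^+ 2 = 4 * be ^+ 2 * (av x ^+ 2 * av y ^+ 2)); last by ring.
    by rewrite ler_wpM2r ?mulr_ge0 // ler_wpM2l.
  have := sqr_ge0 (p * av x ^+ 2 - q * av y ^+ 2); rewrite sqrrB sqrrD; lra.
have -> : c ^+ 2 * (av x ^+ 2 + av y ^+ 2) =
  p * av x ^+ 2 + q * av y ^+ 2 + (al * av x ^+ 2 + ga * av y ^+ 2) by rewrite /p /q; ring.
rewrite -lerBlDr; apply: le_trans h; apply: le_trans eL _.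
by rewrite mulrC.
Qed.

(* In the bases (e1, .) and (w, .), N (X + Y) is diag (2 N, N s) with |s| < 2, so for
   large N only the (1, 1) entry of Z counts at first order. *)
Lemma bnd_large X Y Z (k : R) : orthocols X -> orthocols Y ->
  Y 0 0 = X 0 0 -> Y 1 0 = X 1 0 -> (Y 0 1, Y 1 1) != (X 0 1, X 1 1) ->
  cj (X 0 0) * Z 0 0 + cj (X 1 0) * Z 1 0 = emb k -> 1 < k ->
  exists N c : R, [/\ 0 < N, c < 2 * N - 1 & bnd (emb N *: X - Z + emb N *: Y) c].
Proof.
move=> hX hY eY0 eY1 nXY hZ k1.
have oX := orthocols_cj hX; have oY := orthocols_cj hY; rewrite eY0 eY1 in oY.
case: hX => X1 X2 _; case: hY => _ Y2 _.
have hZ' : X 0 0 * cj (Z 0 0) + X 1 0 * cj (Z 1 0) = emb k.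
  by have := congr1 cj hZ; rewrite cj_emb rmorphD /= !rmorphM /= !cjK.
set a := X 0 0 in X1 hZ hZ' oX oY; set c := X 1 0 in X1 hZ hZ' oX oY.
set b := X 0 1 in X2 oX nXY; set d := X 1 1 in X2 oX nXY.
set b' := Y 0 1 in Y2 oY nXY; set d' := Y 1 1 in Y2 oY nXY.
set z00 := Z 0 0 in hZ hZ'; set z10 := Z 1 0 in hZ hZ'.
set z01 := Z 0 1; set z11 := Z 1 1.
(* By the parallelogram law the second column of X + Y has squared length 4 - e, so e > 0 is the gap
   to the first column, of squared length 4. *)
pose e := av (b - b') ^+ 2 + av (d - d') ^+ 2.
have e0 : 0 < e.
  rewrite lt_def addr_ge0 ?sqr_ge0 // andbT paddr_eq0 ?sqr_ge0 // !sqrf_eq0 !av_eq0.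
  by apply: contra nXY; rewrite !subr_eq0 => /andP[/eqP-> /eqP->].
(* Coefficients in N of the Gram matrix of N (X + Y) - Z: its off-diagonal entry is T0 - N T1,
   because the N ^ 2 part vanishes by orthogonality of the columns, and T2 is the cross term of the
   second column. *)
pose T1 := (2 * cj a * z01 + 2 * cj c * z11) + (cj z00 * (b + b') + cj z10 * (d + d')).
pose T0 := cj z00 * z01 + cj z10 * z11.
pose T2 := (b + b') * cj z01 + (d + d') * cj z11.
pose A0 := av z00 ^+ 2 + av z10 ^+ 2; pose G0 := av z01 ^+ 2 + av z11 ^+ 2.
have A00 : 0 <= A0 by rewrite addr_ge0 ?sqr_ge0.
have G00 : 0 <= G0 by rewrite addr_ge0 ?sqr_ge0.
pose C := A0 + G0 + 2 * av T2 + av T1 + av T0.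
have T00 : 0 <= av T0 by []. have T10 : 0 <= av T1 by []. have T20 : 0 <= av T2 by [].
have C0 : 0 <= C by rewrite /C; lra.
have [N [N0 cN hN]] := large_parameter k1 e0 C0.
exists N, (2 * N - (1 + k) / 2); split => //; first by lra.
have eM : emb N *: X - Z + emb N *: Y = mx22 (2 * emb N * a - z00)
    (emb N * (b + b') - z01) (2 * emb N * c - z10) (emb N * (d + d') - z11).
  apply/matrixP; apply: ord2P; apply: ord2P; rewrite mx22E !mxE ?eY0 ?eY1;
    rewrite /a /b /c /d /z00 /z01 /z10 /z11 /b' /d'; ring.
rewrite eM; set M := mx22 _ _ _ _.
pose al := av (M 0 0) ^+ 2 + av (M 1 0) ^+ 2.
pose ga := av (M 0 1) ^+ 2 + av (M 1 1) ^+ 2.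
pose be := av (cj (M 0 0) * M 0 1 + cj (M 1 0) * M 1 1).
have [||||h1 h2 h3] := hN al ga be; last exact: bnd_cols.
- exact: av_ge0.
- suff -> : al = 4 * N ^+ 2 - 4 * N * k + A0 by rewrite /C; lra.
  apply: (@emb_inj _ _ K); rewrite /al /A0 /M !mx22E.
  rewrite !(rmorph_nat, rmorphXn, rmorphB, rmorphD, rmorphM) /= !emb_av2.
  rewrite !(rmorph_nat, rmorphM, rmorphB) /= !cj_emb.
  transitivity (4 * emb N ^+ 2 * (a * cj a + c * cj c)
    - 2 * emb N * (cj a * z00 + cj c * z10) - 2 * emb N * (a * cj z00 + c * cj z10)
    + (z00 * cj z00 + z10 * cj z10)); first by ring.
  by rewrite X1 hZ hZ'; ring.
- have : ga - (N ^+ 2 * (4 - e) + G0) <= N * (2 * av T2).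
    apply: le_trans (ler_norm _) _.
    rewrite -(av_emb K) (_ : emb _ = - (emb N * (T2 + cj T2))).
      rewrite avN avM av_emb ger0_norm ?(ltW N0) // ler_pM2l //.
      by apply: le_trans (avD _ _ _) _; rewrite av_cj; lra.
    rewrite /ga /e /G0 /M !mx22E.
    rewrite !(rmorph_nat, rmorphXn, rmorphB, rmorphD, rmorphM) /= !emb_av2.
    rewrite /T2 !(rmorph_nat, rmorphM, rmorphB, rmorphD) /= !cj_emb !cjK.
    have -> : 4 = 2 * (b * cj b + d * cj d) + 2 * (b' * cj b' + d' * cj d') :> F.
      by rewrite X2 Y2; ring.
    ring.
  have : N * (2 * av T2) <= N * C by rewrite ler_pM2l // /C; lra.
  have : G0 <= C by rewrite /C; lra.
  lra.
- have -> : be = av (T0 - emb N * T1).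
    rewrite /be /M !mx22E !(rmorph_nat, rmorphM, rmorphB) /= !cj_emb.
    congr av; transitivity (2 * emb N ^+ 2 * (cj a * b + cj c * d)
      + 2 * emb N ^+ 2 * (cj a * b' + cj c * d') + (T0 - emb N * T1)).
      by rewrite /T0 /T1; ring.
    by rewrite oX oY !mulr0 !add0r.
  apply: le_trans (avB _ _ _) _; rewrite avM av_emb ger0_norm ?(ltW N0) //.
  have : N * av T1 <= C * N by rewrite mulrC ler_pM2r // /C; lra.
  have : av T0 <= C by rewrite /C; lra.
  lra.
Qed.

End Shortening.

(** * The strict gain and the assembly of the shorter product *)

Section MainInequality.
Variables (R : realType) (F : numFieldType) (K : rcfield R F).
Local Notation emb := (emb K).
Local Notation cj := (cj K).
Local Notation av := (av K).
Local Notation vn := (vn K).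
Local Notation bnd := (bnd K).
Local Notation reach := (reach K).
Implicit Types X Y Z : 'M[F]_2.

(* With rho = w^* e^(- s X) and p = e^(s X) e1, one has rho X p = 1, so |rho| |p| > 1 unless
   rho^* and X p are parallel; their determinant is s w_1 (det X - 1) + O(s ^ 2).  Z is the
   rank one contraction sending p to a multiple of rho^*. *)
Lemma strict_gain X : orthocols K X -> X 1 0 != 0 ->
  X 0 0 * X 1 1 - X 0 1 * X 1 0 != 1 ->
  exists2 s0 : R, 0 < s0 & forall s : R, s != 0 -> `|s| <= s0 -> exists Z k,
    let Z' := mexp (emb s *: - X) *m Z *m mexp (emb s *: X) in
    [/\ bnd Z 1, 1 < k & cj (X 0 0) * Z' 0 0 + cj (X 1 0) * Z' 1 0 = emb k].
Proof.
move=> hX c0 det1; have [X1 _ X3] := hX.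
have X1' : cj (X 0 0) * X 0 0 + cj (X 1 0) * X 1 0 = 1.
  by rewrite -X1; ring.
pose P s := mexp (emb s *: X); pose E s := mexp (emb s *: - X).
pose rho s j := cj (X 0 0) * E s 0 j + cj (X 1 0) * E s 1 j.
pose y s i := X i 0 * P s 0 0 + X i 1 * P s 1 0.
pose D s := y s 1 * cj (rho s 0) - y s 0 * cj (rho s 1).
have [s0 s00 hD] : exists2 s0 : R, 0 < s0 & forall s : R, s != 0 -> `|s| <= s0 -> D s != 0.
  have hP := mexpands_exp K X; have hE := mexpands_exp K (- X).
  have cst c : expands K (fun=> c) c 0 by exact: expands_cst.
  have hy i := expandsD (expandsM (cst (X i 0)) (hP 0 0)) (expandsM (cst (X i 1)) (hP 1 0)).
  have hr j := expands_cj (expandsD (expandsM (cst (cj (X 0 0))) (hE 0 j))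
    (expandsM (cst (cj (X 1 0))) (hE 1 j))).
  have hD := expandsD (expandsM (hy 1) (hr 0)) (expandsN (expandsM (hy 0) (hr 1))).
  have f1 : X 1 0 * (X 0 0 * X 1 1 - X 0 1 * X 1 0 - 1) != 0.
    by rewrite mulf_neq0 // subr_eq0.
  apply: expands_neq0 f1.
  congr (expands _ _ _ _): hD.
    rewrite !mxE /= !(mulr1n, mulr0n) !(rmorphD, rmorphM, rmorph0, rmorph1) /= !cjK.
    ring.
  rewrite !mxE /= !(mulr1n, mulr0n) !(rmorphD, rmorphN, rmorphM, rmorph0, rmorph1) /= !cjK.
  transitivity (X 1 0 * (X 0 0 * X 1 1 - X 0 1 * X 1 0) -
    X 1 0 * (X 0 0 * cj (X 0 0) + X 1 0 * cj (X 1 0))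
    + X 0 0 * (X 0 0 * cj (X 0 1) + X 1 0 * cj (X 1 1))); first by ring.
  by rewrite X1 X3; ring.
exists s0 => // s sn0 ss0; have {}hD := hD s sn0 ss0.
(* X commutes with its exponential, so the two transports cancel around X. *)
have hEP : E s *m (X *m P s) = X.
  rewrite /P (mexp_comm K) -?scalemxAr -?scalemxAl // mulmxA.
  by rewrite /E scalerN (mexpNK K) mul1mx.
have ry : rho s 0 * y s 0 + rho s 1 * y s 1 = 1.
  rewrite -X1' -{2 4}hEP !mul_mxE /rho /y; ring.
have ny : av (y s 0) ^+ 2 + av (y s 1) ^+ 2 = av (P s 0 0) ^+ 2 + av (P s 1 0) ^+ 2.
  have := vn_iso (col 0 (P s)) hX => /(congr1 (fun t => t ^+ 2)).
  by rewrite !vn_sqr !mul_mxE !mxE.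
pose n1 := Num.sqrt (av (rho s 0) ^+ 2 + av (rho s 1) ^+ 2).
pose n2 := Num.sqrt (av (P s 0 0) ^+ 2 + av (P s 1 0) ^+ 2).
have n1E : n1 ^+ 2 = av (rho s 0) ^+ 2 + av (rho s 1) ^+ 2.
  by rewrite sqr_sqrtr // addr_ge0 ?sqr_ge0.
have n2E : n2 ^+ 2 = av (P s 0 0) ^+ 2 + av (P s 1 0) ^+ 2.
  by rewrite sqr_sqrtr // addr_ge0 ?sqr_ge0.
(* Since X is an isometry, y and p have the same length; Lagrange's identity then adds the squared
   determinant [D s] to |rho y| ^ 2 = 1. *)
have n12 : (n1 * n2) ^+ 2 = 1 + av (D s) ^+ 2.
  rewrite exprMn n1E n2E -ny lagrange ry av1 expr1n; congr (_ + _ ^+ 2).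
  rewrite -[in RHS]av_cj /D rmorphB /= !rmorphM /= !cjK; congr av; ring.
have n1p : 0 <= n1 by apply: sqrtr_ge0.
have n2p : 0 <= n2 by apply: sqrtr_ge0.
have k1 : 1 < n1 * n2.
  rewrite -(@ltr_pXn2r _ 2) ?nnegrE ?mulr_ge0 // expr1n n12 ltrDl exprn_gt0 //.
  by rewrite lt_def av_eq0 hD /=.
have n10 : 0 < n1 by rewrite lt_def n1p andbT; apply: contraTneq k1 => ->; rewrite mul0r ltr10.
have n20 : 0 < n2 by rewrite lt_def n2p andbT; apply: contraTneq k1 => ->; rewrite mulr0 ltr10.
exists (emb (n1 * n2)^-1 *: mx22 (cj (rho s 0) * cj (P s 0 0)) (cj (rho s 0) * cj (P s 1 0))
   (cj (rho s 1) * cj (P s 0 0)) (cj (rho s 1) * cj (P s 1 0))), (n1 * n2).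
split => //; first by apply: bnd_rank1 => //; rewrite !av_cj.
have scE c (A : 'M[F]_2) i j : (c *: A) i j = c * A i j by rewrite mxE.
rewrite -/(P s) -/(E s) -scalemxAr -scalemxAl !scE !mul_mxE !mx22E.
transitivity (emb (n1 * n2)^-1 * ((rho s 0 * cj (rho s 0) + rho s 1 * cj (rho s 1)) *
   (P s 0 0 * cj (P s 0 0) + P s 1 0 * cj (P s 1 0)))).
  move: (cj (rho s 0)) (cj (rho s 1)) => r0 r1; rewrite /rho; ring.
rewrite !mul_cj -!rmorphD /= -n1E -n2E -!rmorphM /=; apply: (congr1 emb).
by field; rewrite !gt_eqF.
Qed.

Lemma reach_iso X r : orthocols K X -> 0 <= r -> reach (mexp (emb r *: X)) r.
Proof.
by move=> hX r0; apply: reach_exp; have := bndZ r (bnd_iso hX); rewrite ger0_norm // mulr1.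
Qed.

Lemma mexp_split (a b : R) X : mexp (emb (a + b) *: X) = mexp (emb a *: X) *m mexp (emb b *: X).
Proof. by rewrite rmorphD /= (mexpZD K). Qed.

Lemma mexp_conjZ X Z (s d : R) :
  mexp (emb d *: - (mexp (emb s *: - X) *m Z *m mexp (emb s *: X))) =
  mexp (emb s *: - X) *m mexp (- (emb d *: Z)) *m mexp (emb s *: X).
Proof.
rewrite -(mexp_conj K); first by rewrite scalerN mulmxN mulNmx -scalemxAr -scalemxAl.
by rewrite scalerN (mexpKN K).
Qed.

(** The detour as an identity: V and its inverse Z are inserted at the right end of the segment S,
    which follows the junction, and V is carried through S to the junction by conjugation. Splitting
    S as B G leaves a piece of each segment next to the conjugate of V. *)
Lemma regroup_left (A B S S' V Z E G W : 'M[F]_2) :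
  S' *m S = 1 -> V *m Z = 1 -> B *m G = S ->
  E *m A *m (S *m W) = E *m ((A *m (S *m V *m S') *m B) *m (G *m (Z *m W))).
Proof.
move=> SS VZ eS; rewrite -!mulmxA (mulmxA B) eS (mulmxA S') SS mul1mx.
by rewrite (mulmxA V) VZ mul1mx.
Qed.

(** Mirror image of [regroup_left]: S precedes the junction and the insertion is at its left end. *)
Lemma regroup_right (A B S S' V Z E G W : 'M[F]_2) :
  S *m S' = 1 -> Z *m V = 1 -> G *m A = S ->
  E *m S *m (B *m W) = E *m (Z *m (G *m ((A *m (S' *m V *m S) *m B) *m W))).
Proof.
move=> SS ZV eS; rewrite -!mulmxA (mulmxA G) eS (mulmxA S S') SS mul1mx.
by rewrite (mulmxA Z) ZV mul1mx.
Qed.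

Lemma min3 (a b c : R) : 0 < a -> 0 < b -> 0 < c ->
  exists d : R, [/\ 0 < d, d <= a, d <= b & d <= c].
Proof.
move=> a0 b0 c0; exists (Num.min a (Num.min b c)).
by rewrite !lt_min a0 b0 c0 !ge_min !lexx ?orbT.
Qed.

(** Around the junction, lengths d N of both segments and the undoing of Z form one block;
    [bnd_large] and [reach_product] give it a cost below (2 N - 1) d instead of 2 N d, and playing Z
    adds only d. *)
Theorem shortening X Y (r1 r2 : R) : orthocols K X -> orthocols K Y -> 0 < r1 -> 0 < r2 ->
  Y 0 0 = X 0 0 -> Y 1 0 = X 1 0 -> X 1 0 != 0 ->
  X 0 0 * X 1 1 - X 0 1 * X 1 0 != Y 0 0 * Y 1 1 - Y 0 1 * Y 1 0 ->
  exists2 t : R, t < r1 + r2 & reach (mexp (emb r1 *: X) *m mexp (emb r2 *: Y)) t.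
Proof.
move=> hX hY r10 r20 e0 e1 c0 nD.
have nXY : (Y 0 1, Y 1 1) != (X 0 1, X 1 1).
  by apply: contraNneq nD => -[-> ->]; rewrite e0 e1.
have [DX|DX] := eqVneq (X 0 0 * X 1 1 - X 0 1 * X 1 0) 1.
  have DY : Y 0 0 * Y 1 1 - Y 0 1 * Y 1 0 != 1 by rewrite -DX eq_sym.
  have [|s0 s00 hs] := strict_gain hY _ DY; first by rewrite e1.
  pose s : R := Num.min s0 r2; have sp : 0 < s by rewrite lt_min s00.
  have sr2 : s <= r2 by rewrite ge_min lexx orbT.
  (* On the side of Y the perturbation is carried back to the junction as exp (s Y) Z exp (- s Y),
     which is the transport of [strict_gain] at - s. *)
  have [||Z [k [hZ k1]]] := hs (- s); first by rewrite oppr_eq0 gt_eqF.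
    by rewrite normrN ger0_norm ?ge_min ?lexx // ltW.
  set Z' := _ *m Z *m _; rewrite e0 e1 => hZ'.
  have [N [c [N0 cN hc]]] := bnd_large hX hY e0 e1 nXY hZ' k1.
  (* The midpoint leaves room on both sides: above c for the correction, below 2 N - 1 for the
     saving. *)
  have cN' : c < (c + (2 * N - 1)) / 2 by lra.
  have [d0 d00 hd] := reach_product hc cN'.
  (* The block takes the length d N from the segment of X and from S, so d N may exceed neither r1
     nor s. *)
  have [d [dp dd0 d1 d2]] := min3 d00 (divr_gt0 r10 N0) (divr_gt0 sp N0).
  have {hd} := hd d dp dd0; rewrite mexp_conjZ rmorphN /= !scaleNr scalerN opprK.
  set A := mexp (_ *: (_ *: X)); set B := mexp (_ *: (_ *: Y)).
  set S := mexp (emb s *: Y) => hK.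
  rewrite ler_pdivlMr // in d1; rewrite ler_pdivlMr // in d2.
  have eX : mexp (emb r1 *: X) = mexp (emb (r1 - d * N) *: X) *m A.
    by rewrite /A scalerA -rmorphM -mexp_split subrK.
  have eY : mexp (emb r2 *: Y) = S *m mexp (emb (r2 - s) *: Y).
    by rewrite -mexp_split subrKC.
  have eS : B *m mexp (emb (s - d * N) *: Y) = S.
    by rewrite /B scalerA -rmorphM -mexp_split subrKC.
  rewrite eX eY (regroup_left _ _ _ (mexpNK K (emb s *: Y)) (mexpNK K (emb d *: Z)) eS).
  (* The total is r1 + r2 - d (2 N - 1 - c) / 2. *)
  exists (r1 - d * N + ((c + (2 * N - 1)) / 2 * d + ((s - d * N) + (d + (r2 - s))))).
    have : d * c < d * (2 * N - 1) by rewrite ltr_pM2l.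
    lra.
  apply: reach_mul; first by apply: reach_iso; rewrite ?subr_ge0.
  apply: reach_mul; first exact: hK.
  apply: reach_mul; first by apply: reach_iso; rewrite ?subr_ge0.
  apply: reach_mul; last by apply: reach_iso; rewrite ?subr_ge0.
  by apply: reach_exp; have := bndZ d hZ; rewrite ger0_norm ?mulr1 // ltW.
have [s0 s00 hs] := strict_gain hX c0 DX.
pose s : R := Num.min s0 r1; have sp : 0 < s by rewrite lt_min s00.
have sr1 : s <= r1 by rewrite ge_min lexx orbT.
have [||Z [k [hZ k1]]] := hs s; first by rewrite gt_eqF.
  by rewrite ger0_norm ?ge_min ?lexx // ltW.
set Z' := _ *m Z *m _ => hZ'.
have [N [c [N0 cN hc]]] := bnd_large hX hY e0 e1 nXY hZ' k1.
have cN' : c < (c + (2 * N - 1)) / 2 by lra.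
have [d0 d00 hd] := reach_product hc cN'.
have [d [dp dd0 d1 d2]] := min3 d00 (divr_gt0 r20 N0) (divr_gt0 sp N0).
have {hd} := hd d dp dd0; rewrite mexp_conjZ scalerN.
set A := mexp (_ *: (_ *: X)); set B := mexp (_ *: (_ *: Y)).
set S := mexp (emb s *: X) => hK.
rewrite ler_pdivlMr // in d1; rewrite ler_pdivlMr // in d2.
have eY : mexp (emb r2 *: Y) = B *m mexp (emb (r2 - d * N) *: Y).
  by rewrite /B scalerA -rmorphM -mexp_split subrKC.
have eX : mexp (emb r1 *: X) = mexp (emb (r1 - s) *: X) *m S.
  by rewrite -mexp_split subrK.
have eS : mexp (emb (s - d * N) *: X) *m A = S.
  by rewrite /A scalerA -rmorphM -mexp_split subrK.
rewrite eX eY (regroup_right _ _ _ (mexpKN K (emb s *: X)) (mexpKN K (emb d *: Z)) eS).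
exists (r1 - s + (d + ((s - d * N) + ((c + (2 * N - 1)) / 2 * d + (r2 - d * N))))).
  have : d * c < d * (2 * N - 1) by rewrite ltr_pM2l.
  lra.
apply: reach_mul; first by apply: reach_iso; rewrite ?subr_ge0.
apply: reach_mul.
  by apply: reach_exp; have := bndZ d hZ; rewrite ger0_norm ?mulr1 // ltW.
apply: reach_mul; first by apply: reach_iso; rewrite ?subr_ge0.
by apply: reach_mul; [exact: hK|apply: reach_iso; rewrite // subr_ge0].
Qed.

End MainInequality.

(** * Real and complex numbers *)

Section RealInstance.
Variable R : realType.
Implicit Types x y z : R.

Lemma exp_series_cvg z :
  (fun n => series (fun k => (k`!%:R)^-1 * z ^+ k) n : R) @ \oo --> expR z.
Proof.
have -> : (fun k => (k`!%:R)^-1 * z ^+ k) = exp_coeff z.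
  by apply/funext => k; rewrite /exp_coeff /= mulrC.
exact: is_cvg_series_exp_coeff.
Qed.

Lemma cvg_dist (u : nat -> R) (l : R) : u @ \oo --> l -> (fun n => `|u n - l|) @ \oo --> (0 : R).
Proof. move=> /cvgrPdist_lt h; apply/cvgrPdist_lt => e /h; apply: filterS => n.
by rewrite sub0r normrN normr_id distrC. Qed.

(** The upper bound is ln d <= d - 1; the lower one is the same inequality at 1 / d, where 1 / d <=
    2 gives the factor 2. *)
Lemma ln_near1 (d : R) : `|d - 1| <= 2^-1 -> `|ln d| <= 2 * `|d - 1|.
Proof.
rewrite ler_norml => /andP[d1 d2]; have d0 : 0 < d by lra.
have h1 : ln d <= d - 1 by have := @le_ln1Dx R (d - 1); rewrite subrKC; apply; lra.
have h2 : - ln d <= d^-1 - 1.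
  have := @le_ln1Dx R (d^-1 - 1); rewrite subrKC -lnV ?posrE //; apply.
  by rewrite ltrBrDl subrr invr_gt0.
have i2 : d^-1 <= 2 by rewrite -[2]invrK lef_pV2 ?posrE //; lra.
have h3 : d^-1 - 1 <= 2 * `|d - 1|.
  have -> : d^-1 - 1 = d^-1 * (1 - d) by field; rewrite gt_eqF.
  apply: le_trans (ler_norm _) _; rewrite normrM distrC ler_wpM2r //.
  by rewrite ger0_norm // invr_ge0 ltW.
have h4 : d - 1 <= 2 * `|d - 1| by have := ler_norm (d - 1); have := normr_ge0 (d - 1); lra.
by rewrite ler_norml; apply/andP; split; lra.
Qed.

(** Mean value theorem: the derivative 1 / (1 + c ^ 2) is at most 1. *)
Lemma norm_atan_le x : `|atan x| <= `|x|.
Proof.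
wlog x0 : x / 0 <= x => [h|].
  by have [/h//|/ltW x0] := leP 0 x; rewrite -normrN -atanN -[leRHS]normrN h // oppr_ge0.
have [|c _] := @MVT_segment R atan (fun c => (1 + c ^+ 2)^-1) 0 x x0.
  by apply: continuous_subspaceT => y; exact: continuous_atan.
rewrite atan0 !subr0 => ->; rewrite normrM ler_piMl //.
have h : 1 <= 1 + c ^+ 2 by rewrite lerDl sqr_ge0.
by rewrite ger0_norm ?invr_ge0 ?invf_le1 //; lra.
Qed.

Lemma real_abs_cvg (u : nat -> R) : cvgn (series (fun n => `|u n|)) ->
  exists l, (fun n => `|series u n - l|) @ \oo --> (0 : R).
Proof.
by move=> /(normed_cvg (V := R^o)) h; exists (limn (series u)); exact: cvg_dist.
Qed.

Lemma real_exp_near1 (d : R) : `|d - 1| <= 2^-1 -> exists z1 z2 d1 d2 : R,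
  [/\ d = d1 * d2, `|z1| <= 4 * `|d - 1|, `|z2| <= 4 * `|d - 1|,
    (fun n => `|series (fun k => (k`!%:R)^-1 * z1 ^+ k) n - d1|) @ \oo --> (0 : R)
  & (fun n => `|series (fun k => (k`!%:R)^-1 * z2 ^+ k) n - d2|) @ \oo --> (0 : R)].
Proof.
(* Over R a single logarithm suffices, and the second factor is exp 0. *)
move=> hd; exists (ln d), 0, d, 1; split.
- by rewrite mulr1.
- by apply: le_trans (ln_near1 hd) _; rewrite ler_wpM2r // ler_nat.
- by rewrite normr0 mulr_ge0.
- have d0 : 0 < d by move: hd; rewrite ler_norml => /andP[]; lra.
  by have := cvg_dist (@exp_series_cvg (ln d)); rewrite lnK ?posrE.
- by have := cvg_dist (@exp_series_cvg 0); rewrite expR0.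
Qed.

Definition real_rcfield : rcfield R R := @Rcfield R R idfun idfun (fun x => `|x|)
  (fun=> erefl) (fun _ _ => erefl) (fun e _ => ex_intro _ e erefl) (fun=> erefl) (fun=> erefl)
  (fun x => esym (real_normK (num_real x))) real_abs_cvg real_exp_near1.

End RealInstance.

Section ComplexInstance.
Variable R : realType.
Implicit Types z : R[i].
Local Notation normc := (@ComplexField.Normc.normc R).
Local Notation "x %:C" := (real_complex R x).

Lemma normcE z : (normc z)%:C = `|z|.
Proof. by []. Qed.

Lemma normc_ge0 z : 0 <= normc z.
Proof. by case: z => a b; exact: sqrtr_ge0. Qed.

Lemma emb_pos_complex (e : R[i]) : 0 < e -> exists e', e = e'%:C.
Proof. by case: e => a b; rewrite ltcE /= => /andP[/eqP-> _]; exists a. Qed.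

Lemma mul_conjc z : z * conjc z = (normc z ^+ 2)%:C.
Proof.
case: z => a b; rewrite /= sqr_sqrtr ?addr_ge0 ?sqr_ge0 //.
by apply/eqP; rewrite eq_complex /= mulrN opprK -!expr2 eqxx mulrN [b * a]mulrC addNr eqxx.
Qed.

Lemma normc_le_ReIm z : normc z <= `|complex.Re z| + `|complex.Im z|.
Proof.
case: z => a b /=; rewrite -(@ler_pXn2r _ 2) ?nnegrE ?sqrtr_ge0 ?addr_ge0 //.
rewrite sqr_sqrtr ?addr_ge0 ?sqr_ge0 // sqrrD !real_normK ?num_real // lerD2r lerDl.
by rewrite mulrn_wge0 // mulr_ge0.
Qed.

Lemma Re_le_normc z : `|complex.Re z| <= normc z.
Proof.
case: z => a b /=; rewrite -sqrtr_sqr ler_wsqrtr // lerDl sqr_ge0 //.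
Qed.

Lemma Im_le_normc z : `|complex.Im z| <= normc z.
Proof.
case: z => a b /=; rewrite -sqrtr_sqr ler_wsqrtr // lerDr sqr_ge0 //.
Qed.

Lemma seriesC (u : nat -> R[i]) n :
  series u n = Complex (series (fun k => complex.Re (u k)) n) (series (fun k => complex.Im (u k)) n).
Proof.
rewrite /series /=; elim: n => [|n IH]; first by rewrite !big_nil.
by rewrite !big_nat_recr //= IH; case: (u n).
Qed.

Lemma cvg_complex (u : nat -> R[i]) (a b : R) :
  (fun n => complex.Re (u n)) @ \oo --> a -> (fun n => complex.Im (u n)) @ \oo --> b ->
  (fun n => normc (u n - Complex a b)) @ \oo --> (0 : R).
Proof.
move=> /cvg_dist ha /cvg_dist hb.
apply: (squeeze_cvgr (f := fun=> 0)
  (h := fun n => `|complex.Re (u n) - a| + `|complex.Im (u n) - b|)).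
- near=> n; apply/andP; split; last by apply: le_trans (normc_le_ReIm _) _; case: (u n).
  exact: normc_ge0.
- exact: cvg_cst.
- by rewrite -[X in _ --> X]addr0; exact: cvgD.
Unshelve. all: by end_near. Qed.

Lemma complex_abs_cvg (u : nat -> R[i]) : cvgn (series (fun n => normc (u n))) ->
  exists l, (fun n => normc (series u n - l)) @ \oo --> (0 : R).
Proof.
move=> h.
have cvgp (p : R[i] -> R) : (forall z, `|p z| <= normc z) -> cvgn (series (fun k => p (u k))).
  move=> hp; apply: (normed_cvg (V := R^o)).
  apply: series_le_cvg h => n; [exact: normr_ge0|exact: normc_ge0|exact: hp].
exists (Complex (limn (series (fun k => complex.Re (u k)))) (limn (series (fun k => complex.Im (u k))))).
apply: cvg_complex.
  rewrite (_ : (fun n => _) = series (fun k => complex.Re (u k))); first exact/cvgp/Re_le_normc.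
  by apply/funext => n; rewrite seriesC.
rewrite (_ : (fun n => _) = series (fun k => complex.Im (u k))); first exact/cvgp/Im_le_normc.
by apply/funext => n; rewrite seriesC.
Qed.

Lemma complex_exp_real (x : R) :
  (fun n => normc (series (fun k => (k`!%:R)^-1 * x%:C ^+ k) n - (expR x)%:C)) @ \oo --> (0 : R).
Proof.
have e k : (k`!%:R)^-1 * x%:C ^+ k = (exp_coeff x k)%:C.
  by rewrite /exp_coeff /= mulrC rmorphM /= fmorphV /= rmorph_nat rmorphXn.
apply: cvg_complex.
  rewrite (_ : (fun n => _) = series (exp_coeff x)); first exact: is_cvg_series_exp_coeff.
  by apply/funext => n; rewrite seriesC; congr series; apply/funext => k; rewrite e.
rewrite (_ : (fun n => _) = fun=> 0); first exact: cvg_cst.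
by apply/funext => n; rewrite seriesC /series /= big1 // => k _; rewrite e.
Qed.

(** Even powers of i x are real and odd ones imaginary, so the two parts of the series are those of
    cos and sin. *)
Lemma complex_exp_imaginary (x : R) :
  (fun n => normc (series (fun k => (k`!%:R)^-1 * (Complex 0 x) ^+ k) n - Complex (cos x) (sin x)))
    @ \oo --> (0 : R).
Proof.
have e2 m : (Complex 0 x) ^+ m.*2 = ((-1) ^+ m * x ^+ m.*2)%:C.
  have -> : (Complex 0 x) ^+ m.*2 = ((- x ^+ 2)%:C) ^+ m.
    rewrite -mul2n exprM; congr (_ ^+ m); rewrite [LHS]expr2.
    by apply/eqP; rewrite eq_complex /= !(mul0r, mulr0, addr0, sub0r) expr2 !eqxx.
  by rewrite -rmorphXn -[- _]mulN1r exprMn -exprM mul2n.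
have e k : (k`!%:R)^-1 * (Complex 0 x) ^+ k = Complex (cos_coeff x k) (sin_coeff x k).
  rewrite -(rmorph_nat (real_complex R)) -fmorphV /cos_coeff /sin_coeff /=.
  move: (k`!%:R^-1) => f; rewrite -(odd_double_half k); move: k./2 => m.
  case: (odd k); rewrite ?add1n ?add0n /= odd_double /= ?doubleK.
    rewrite exprS e2 -?exprnP; apply/eqP; rewrite eq_complex /=.
    apply/andP; split; apply/eqP; first by ring.
    by rewrite exprS; ring.
  by rewrite e2 -?exprnP; apply/eqP; rewrite eq_complex /=; apply/andP; split; apply/eqP; ring.
apply: cvg_complex.
  rewrite (_ : (fun n => _) = series (cos_coeff x)).
    by rewrite unlock; exact: is_cvg_series_cos_coeff.
  by apply/funext => n; rewrite seriesC; congr series; apply/funext => k; rewrite e.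
rewrite (_ : (fun n => _) = series (sin_coeff x)).
  by rewrite unlock; exact: is_cvg_series_sin_coeff.
by apply/funext => n; rewrite seriesC; congr series; apply/funext => k; rewrite e.
Qed.

(* d = |d| e^(i t) with t = atan (Im d / Re d). *)
Lemma complex_exp_near1 (d : R[i]) : normc (d - 1) <= 2^-1 -> exists z1 z2 d1 d2,
  [/\ d = d1 * d2, normc z1 <= 4 * normc (d - 1), normc z2 <= 4 * normc (d - 1),
    (fun n => normc (series (fun k => (k`!%:R)^-1 * z1 ^+ k) n - d1)) @ \oo --> (0 : R)
  & (fun n => normc (series (fun k => (k`!%:R)^-1 * z2 ^+ k) n - d2)) @ \oo --> (0 : R)].
Proof.
set e := normc (d - 1) => he.
have e0 : 0 <= e by exact: normc_ge0.
pose rho := normc d; have hrho : `|rho - 1| <= e.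
  have h1 : rho <= 1 + e.
    by have := le_normcD 1 (d - 1); rewrite subrKC ComplexField.Normc.normc1.
  have h2 : 1 <= rho + e.
    have := le_normcD d (1 - d).
    by rewrite subrKC ComplexField.Normc.normc1 -[normc (1 - d)]normcN opprB.
  by rewrite ler_norml; apply/andP; split; lra.
have rho0 : 0 < rho by move: hrho; rewrite ler_norml => /andP[]; lra.
have hRe : `|complex.Re d - 1| <= e.
  apply: le_trans (Re_le_normc _).
  by rewrite (_ : complex.Re (d - 1) = complex.Re d - 1) //; case: (d).
have hIm : `|complex.Im d| <= e.
  apply: le_trans (Im_le_normc _); rewrite (_ : complex.Im (d - 1) = complex.Im d) //.
  by case: (d) => a b /=; rewrite subr0.
pose t := complex.Im d / complex.Re d.
have Re2 : 2^-1 <= complex.Re d by move: hRe; rewrite ler_norml => /andP[]; lra.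
exists (ln rho)%:C, (Complex 0 (atan t)), rho%:C, (Complex (cos (atan t)) (sin (atan t))).
(* Here |t| = |Im d| / Re d with |Im d| <= e and Re d >= 1 / 2. *)
have tE : `|atan t| <= 2 * e.
  apply: le_trans (norm_atan_le _) _; rewrite normrM mulrC; apply: ler_pM => //.
  by rewrite normfV -[2]invrK lef_pV2 ?posrE ?normr_gt0 ?ger0_norm ?gt_eqF //; lra.
have rhoE : rho = complex.Re d * Num.sqrt (1 + t ^+ 2).
  apply: (pexpIrn (n := 2)) => //; rewrite ?nnegrE ?mulr_ge0 ?sqrtr_ge0 ?normc_ge0 //; first lra.
  rewrite exprMn sqr_sqrtr ?addr_ge0 ?sqr_ge0 // /t /rho.
  have {Re2} : 0 < complex.Re d by lra.
  case: (d) => a b /= a0.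
  by rewrite sqr_sqrtr ?addr_ge0 ?sqr_ge0 //; field; rewrite gt_eqF.
have q0 : Num.sqrt (1 + t ^+ 2) != 0 by rewrite gt_eqF // sqrtr_gt0 ltr_wpDr ?sqr_ge0.
have sE : sin (atan t) = t * cos (atan t).
  by rewrite -{2}[t]atanK /tan divfK // cos_atan invr_eq0.
split.
- rewrite sE cos_atan rhoE.
  have a0 : complex.Re d != 0 by rewrite gt_eqF //; lra.
  apply/eqP; rewrite eq_complex /= !(mul0r, subr0, addr0).
  by apply/andP; split; apply/eqP; rewrite /t; field; rewrite ?a0 ?q0.
- rewrite /= expr0n /= addr0 sqrtr_sqr; apply: le_trans (ln_near1 _) _; lra.
- rewrite /= expr0n /= add0r sqrtr_sqr; lra.
- by have := complex_exp_real (ln rho); rewrite lnK ?posrE.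
- exact: complex_exp_imaginary.
Qed.

Definition complex_rcfield : rcfield R R[i] := @Rcfield R R[i] (real_complex R) (@conjc R) normc
  normcE (@lecR R) emb_pos_complex (@conjcK R) (@conjc_real R)
  mul_conjc complex_abs_cvg complex_exp_near1.

End ComplexInstance.

(** * The Magnus exponent *)

Section MagnusBound.
Variables (R : realType) (F : numFieldType) (K : rcfield R F).
Local Notation emb := (emb K).
Local Notation cj := (cj K).
Local Notation av := (av K).
Local Notation vn := (vn K).
Local Notation bnd := (bnd K).
Local Notation reach := (reach K).
Implicit Types A B G U V W X Y Z : 'M[F]_2.

(** Over R[i] this unfolds to [opnormC]; over R the agreement with [opnormR] uses |x| ^ 2 = x ^ 2,
    see [opnormRE]. *)
Definition opnorm A : R := sup [set vn (A *m v) | v in [set v | vn v = 1]].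

Lemma exists_unit : exists v, vn v = 1.
Proof.
exists (col 0 1%:M); apply: (pexpIrn (n := 2)) => //; rewrite ?nnegrE //.
by rewrite vn_sqr !mxE /= av1 av0 !expr1n expr0n addr0.
Qed.

Lemma opnorm_le A c : bnd A c -> opnorm A <= c.
Proof.
move=> h; have [v v1] := exists_unit; apply: ge_sup; first by exists (vn (A *m v)), v.
by move=> _ [u /= u1 <-]; have := h u; rewrite u1 mulr1.
Qed.

Lemma le_opnorm A v : vn v = 1 -> vn (A *m v) <= opnorm A.
Proof.
move=> v1; apply: ub_le_sup; last by exists v.
by exists (nm K A) => _ [u /= u1 <-]; have := bnd_nm K A u; rewrite u1 mulr1.
Qed.

Lemma opnorm_ge0 A : 0 <= opnorm A.
Proof. by have [v /(le_opnorm A)] := exists_unit; apply: le_trans. Qed.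

Lemma reach_magnus G c : reach G c -> magnus opnorm G <= c.
Proof.
move=> rG.
have [s [s0 sG sc]] : exists s, [/\ s != [::], \prod_(B <- rev s) mexp B = G
    & \sum_(B <- s) opnorm B <= c].
  elim: {G c} rG => [A c h|G H c d _ [s [s0 <- sc]] _ [t [t0 <- td]]].
    by exists [:: A]; rewrite /= !big_seq1; split => //; exact: opnorm_le.
  (* The definition multiplies in reverse order, so the list of the left factor G comes last. *)
  exists (t ++ s); split; first by case: (t) t0.
    by rewrite rev_cat big_cat.
  by rewrite big_cat /= addrC lerD.
apply: le_trans sc; apply: ge_inf; last by exists s.
by exists 0 => _ [t [_ _ ->]]; apply: sumr_ge0 => B _; exact: opnorm_ge0.
Qed.

Definition adj A : 'M[F]_2 := (map_mx cj A)^T.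

Lemma adjE A i j : adj A i j = cj (A j i).
Proof. by rewrite !mxE. Qed.

Lemma adjM A B : adj (A *m B) = adj B *m adj A.
Proof. by rewrite /adj map_mxM trmx_mul. Qed.

Lemma adjK A : adj (adj A) = A.
Proof. by apply/matrixP => i j; rewrite !adjE cjK. Qed.

Lemma orthocolsP X : adj X *m X = 1 <-> orthocols K X.
Proof.
split=> [h|[h1 h2 h3]].
  have e i j : cj (X 0 i) * X 0 j + cj (X 1 i) * X 1 j = (1%:M : 'M[F]_2) i j.
    by have := congr1 (fun M : 'M[F]_2 => M i j) h; rewrite mul_mxE !adjE.
  by split; [move: (e 0 0)|move: (e 1 1)|move: (e 1 0)]; rewrite mxE /= => e'; rewrite -[RHS]e'; ring.
have h3' : cj (X 0 0) * X 0 1 + cj (X 1 0) * X 1 1 = 0.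
  exact: orthocols_cj.
apply/matrixP; apply: ord2P; apply: ord2P; rewrite mul_mxE !adjE [RHS]mxE /=.
- by rewrite -[RHS]h1; ring.
- by rewrite -[RHS]h3'; ring.
- by rewrite -[RHS]h3; ring.
- by rewrite -[RHS]h2; ring.
Qed.

Lemma orthocols_conj V X : orthocols K V -> orthocols K X -> orthocols K (adj V *m X *m V).
Proof.
move=> /orthocolsP hV /orthocolsP hX; apply/orthocolsP.
rewrite !adjM adjK !mulmxA -(mulmxA _ V) (mulmx1C hV) mulmx1 -(mulmxA _ _ X) hX mulmx1.
by [].
Qed.

(** Conjugation by a unitary matrix moves inside each exponential and preserves [bnd]. *)
Lemma reach_conj V G c : orthocols K V -> reach G c -> reach (V *m G *m adj V) c.
Proof.
move=> hV; have /orthocolsP VV := hV; elim=> {G c} [A c h|G H c d _ IG _ IH].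
  rewrite -(mexp_conj K) //; apply: reach_exp => v.
  have -> : vn v = vn (adj V *m v).
    by rewrite -[RHS](vn_iso _ hV) mulmxA (mulmx1C VV) mul1mx.
  by rewrite -!mulmxA vn_iso //; exact: h.
have -> : V *m (G *m H) *m adj V = (V *m G *m adj V) *m (V *m H *m adj V).
  by rewrite !mulmxA -(mulmxA _ _ V) VV mulmx1.
exact: reach_mul.
Qed.

Definition det2 A := A 0 0 * A 1 1 - A 0 1 * A 1 0.

Lemma det2M A B : det2 (A *m B) = det2 A * det2 B.
Proof. by rewrite /det2 !mul_mxE; ring. Qed.

Lemma det2_1 : det2 1 = 1.
Proof. by rewrite -[1]/(1%:M) -mx22_1 /det2 !mx22E; ring. Qed.

Lemma det2_conj V X : orthocols K V -> det2 (adj V *m X *m V) = det2 X.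
Proof.
by move=> /orthocolsP hV; rewrite !det2M mulrAC -det2M hV det2_1 mul1r.
Qed.

(** Tested on the unit vector V v. This bound lets r1 + r2 in [shortening] be replaced by the sum of
    the operator norms. *)
Lemma opnorm_ge_iso V X r : orthocols K V -> orthocols K X -> 0 <= r ->
  r <= opnorm (V *m (emb r *: X) *m adj V).
Proof.
move=> hV hX r0; have [v v1] := exists_unit.
have /orthocolsP VV := hV.
have hVv : vn (V *m v) = 1 by rewrite vn_iso.
apply: le_trans (le_opnorm _ hVv).
rewrite -!mulmxA (mulmxA _ V) VV mul1mx vn_iso // -scalemxAl vnZ av_emb vn_iso //.
by rewrite v1 mulr1 ger0_norm.
Qed.

Theorem magnus_lt A B V X Y (r1 r2 : R) : orthocols K V -> orthocols K X -> orthocols K Y ->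
  0 < r1 -> 0 < r2 ->
  Y 0 0 = X 0 0 -> Y 1 0 = X 1 0 -> X 1 0 != 0 -> det2 X != det2 Y ->
  A = V *m (emb r1 *: X) *m adj V -> B = V *m (emb r2 *: Y) *m adj V ->
  magnus opnorm (mexp A *m mexp B) < opnorm A + opnorm B.
Proof.
move=> hV hX hY r10 r20 e0 e1 c0 nD eA eB; have VV : adj V *m V = 1 by apply/orthocolsP.
have [t tr rt] := shortening hX hY r10 r20 e0 e1 c0 nD.
have -> : mexp A *m mexp B = V *m (mexp (emb r1 *: X) *m mexp (emb r2 *: Y)) *m adj V.
  rewrite eA eB !(mexp_conj K) //.
  move: (mexp _) (mexp _) => P Q.
  by rewrite !mulmxA -(mulmxA _ _ V) VV mulmx1.
apply: le_lt_trans (reach_magnus (reach_conj hV rt)) _; apply: lt_le_trans tr _.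
by rewrite eA eB; apply: lerD; apply: opnorm_ge_iso => //; exact: ltW.
Qed.

End MagnusBound.

(** * Skew-aligned pairs as multiples of unitary matrices *)

Section Complex.
Variable R : realType.
Local Notation K := (complex_rcfield R).
Local Notation "x %:C" := (real_complex R x).

Lemma adjCE (A : 'M[R[i]]_2) : adjC A = adj K A.
Proof. by []. Qed.

Lemma expi_conj (x : R) : expi x * conjc (expi x) = 1.
Proof.
apply/eqP; rewrite eq_complex /= mulrN opprK -!expr2 cos2Dsin2 eqxx /=.
by rewrite mulrN [sin x * _]mulrC addNr.
Qed.

Lemma expi_neq0 (x : R) : expi x != 0.
Proof. by apply/eqP => h; have /eqP := expi_conj x; rewrite h mul0r eq_sym oner_eq0. Qed.

(** If x < y, half the difference h lies strictly between 0 and pi, so sin h > 0, which contradicts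
    cos (2 h) = 1. *)
Lemma expi_inj (x y : R) : 0 <= x < 2 * pi -> 0 <= y < 2 * pi -> expi x = expi y -> x = y.
Proof.
wlog xy : x y / x <= y => [h hx hy e|].
  by have [/h->//|/ltW/h->] := leP x y.
move=> /andP[x0 _] /andP[_ y2] [ec es]; apply/eqP; rewrite eq_le xy leNgt; apply/negP => lt_xy.
pose h := (y - x) / 2.
have : 0 < sin h by apply: sin_gt0_pi; rewrite /h; apply/andP; split; lra.
have h1 : cos (h + h) = 1.
  by rewrite (_ : h + h = y - x) ?cosB ?ec ?es -?expr2 ?cos2Dsin2 // /h; field.
have := cos2Dsin2 h; move: h1; rewrite cosD; nra.
Qed.

Definition skew_unit (t eta th : R) : 'M[R[i]]_2 :=
  mx22 (expi eta * (cos t)%:C) (- (expi th * (sin t)%:C))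
       (expi eta * (sin t)%:C) (expi th * (cos t)%:C).

Lemma cos2Dsin2C (t : R) : (cos t)%:C * (cos t)%:C + (sin t)%:C * (sin t)%:C = 1.
Proof. by rewrite -!rmorphM -rmorphD -!expr2 cos2Dsin2. Qed.

Lemma skew_unit_orthocols (t eta th : R) : orthocols K (skew_unit t eta th).
Proof.
have h := cos2Dsin2C t.
have e1 : expi eta * cj K (expi eta) = 1 := expi_conj eta.
have e2 : expi th * cj K (expi th) = 1 := expi_conj th.
have hc : cj K (cos t)%:C = (cos t)%:C := cj_emb K _.
have hs : cj K (sin t)%:C = (sin t)%:C := cj_emb K _.
rewrite /orthocols /skew_unit !mx22E !rmorphN !rmorphM hc hs; split.
- rewrite -[RHS]h -[X in _ = X]mul1r -[X in _ = X * _]e1; ring.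
- rewrite -[RHS]h -[X in _ = X]mul1r -[X in _ = X * _]e2; ring.
- ring.
Qed.

Lemma det2_skew_unit (t eta th : R) : det2 (skew_unit t eta th) = expi eta * expi th.
Proof.
rewrite /det2 /skew_unit !mx22E -[RHS]mulr1 -(cos2Dsin2C t); ring.
Qed.

Lemma skew_unit10_neq0 (t eta th : R) : 0 < t < pi -> skew_unit t eta th 1 0 != 0.
Proof.
move=> ht; rewrite /skew_unit mx22E mulf_neq0 ?expi_neq0 //.
by rewrite eq_complex /= eqxx andbT gt_eqF // sin_gt0_pi.
Qed.

(** In the skew form the first column depends only on t and eta, hence is shared; 0 < t < pi makes
    its lower entry nonzero; the determinant e^(i (eta + theta)) separates X from Y because phi and
    theta differ. *)
Lemma skew_aligned_unitary (A B : 'M[R[i]]_2) : skew_aligned A B ->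
  exists U X Y (r1 r2 : R), [/\ orthocols K U, orthocols K X & orthocols K Y] /\
  [/\ 0 < r1, 0 < r2, Y 0 0 = X 0 0, Y 1 0 = X 1 0 & X 1 0 != 0] /\
  [/\ det2 X != det2 Y, A = U *m (r1%:C *: X) *m adj K U & B = U *m (r2%:C *: Y) *m adj K U].
Proof.
move=> [W [WW [r1 [r2 [t [eta [th [ph [[r10 r20 ht] [heta hth hph nph] hA hB]]]]]]]]].
rewrite !adjCE in WW hA hB.
exists (adj K W), (skew_unit t eta th), (skew_unit t eta ph), r1, r2.
have conjW (M N : 'M[R[i]]_2) : W *m M *m adj K W = N -> M = adj K W *m N *m adj K (adj K W).
  move=> <-; rewrite adjK !mulmxA (mulmx1C WW) mul1mx -!mulmxA (mulmx1C WW).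
  by rewrite mulmx1.
split; first by split; try exact: skew_unit_orthocols; apply/orthocolsP; rewrite adjK.
split.
  rewrite /skew_unit !mx22E; split => //.
  by have := skew_unit10_neq0 eta th ht; rewrite mx22E.
split; [|exact: conjW|exact: conjW].
rewrite !det2_skew_unit; apply: contra nph => /eqP/(mulfI (expi_neq0 eta)) /(expi_inj hth hph) ->.
by [].
Qed.

End Complex.

(** * The real case: a real common vector in place of the complex basis *)

Section Real.
Variable R : realType.
Local Notation K := (real_rcfield R).
Local Notation KC := (complex_rcfield R).
Local Notation "x %:C" := (real_complex R x).
Implicit Types (A B X Y V : 'M[R]_2) (a b c d : R).

Lemma opnormRE : @opnormR R = opnorm K.
Proof.
have h : @vnormR R = vn K.
  apply/funext => v; rewrite /vnormR /vn; congr Num.sqrt.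
  by apply: eq_bigr => i _; rewrite real_normK ?num_real.
by rewrite /opnormR /opnorm h.
Qed.

(** A rotation or a reflection: the second column is the first one turned by a right angle, times
    the determinant. *)
Lemma orthocols_real X : orthocols K X ->
  [/\ det2 X ^+ 2 = 1, X 0 1 = - (det2 X * X 1 0), X 1 1 = det2 X * X 0 0
    & X 0 0 ^+ 2 + X 1 0 ^+ 2 = 1].
Proof.
rewrite /orthocols /= /det2; move: (X 0 0) (X 0 1) (X 1 0) (X 1 1) => a b c d [h1 h2 h3].
split.
- transitivity ((a * a + c * c) * (b * b + d * d) - (a * b + c * d) ^+ 2); first by ring.
  by rewrite h1 h2 h3; ring.
- transitivity (b * (a * a + c * c) - a * (a * b + c * d)); first by rewrite h1 h3; ring.
  ring.
- transitivity (d * (a * a + c * c) - c * (a * b + c * d)); first by rewrite h1 h3; ring.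
  ring.
- by rewrite -h1; ring.
Qed.

(** A unit kernel vector of X - Y, where X is the rotation with first column (a, c) and Y the
    reflection with first column (a', c'). The determinant of X - Y is a ^ 2 + c ^ 2 - a' ^ 2 - c' ^
    2 = 0, so a vector orthogonal to a row serves; the second row is used when the first one
    vanishes. *)
Lemma unit_kernel c a' c' a : c != 0 -> a ^+ 2 + c ^+ 2 = 1 -> a' ^+ 2 + c' ^+ 2 = 1 ->
  exists v0 v1, [/\ v0 ^+ 2 + v1 ^+ 2 = 1, (a - a') * v0 = (c + c') * v1
    & (c - c') * v0 = - ((a + a') * v1)].
Proof.
move=> c0 h h'.
have normalize u0 u1 : u0 ^+ 2 + u1 ^+ 2 != 0 -> (a - a') * u0 = (c + c') * u1 ->
    (c - c') * u0 = - ((a + a') * u1) ->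
    exists v0 v1, [/\ v0 ^+ 2 + v1 ^+ 2 = 1, (a - a') * v0 = (c + c') * v1
      & (c - c') * v0 = - ((a + a') * v1)].
  move=> n0 e1 e2; pose n := Num.sqrt (u0 ^+ 2 + u1 ^+ 2).
  have n2 : n ^+ 2 = u0 ^+ 2 + u1 ^+ 2 by rewrite sqr_sqrtr ?addr_ge0 ?sqr_ge0.
  have n0' : n != 0 by apply: contra n0 => /eqP e; rewrite -n2 e expr0n.
  exists (u0 / n), (u1 / n); split.
  - by rewrite !expr_div_n -mulrDl -n2 divff ?expf_neq0.
  - by rewrite !mulrA e1.
  - by rewrite !mulrA e2 mulNr.
have [hz|hz] := eqVneq ((c + c') ^+ 2 + (a - a') ^+ 2) 0.
  apply: (normalize (a + a') (c' - c)).
  - move: hz => /eqP; rewrite paddr_eq0 ?sqr_ge0 // !sqrf_eq0 => /andP[/eqP h1 /eqP h2].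
    have -> : a' = a by lra.
    have -> : c' = - c by lra.
    have -> : (a + a) ^+ 2 + (- c - c) ^+ 2 = 4 * (a ^+ 2 + c ^+ 2) by ring.
    by rewrite h mulr1 pnatr_eq0.
  - have : a ^+ 2 + c ^+ 2 = a' ^+ 2 + c' ^+ 2 by rewrite h h'.
    lra.
  - ring.
apply: (normalize (c + c') (a - a')) => //; first by ring.
have : a ^+ 2 + c ^+ 2 = a' ^+ 2 + c' ^+ 2 by rewrite h h'.
lra.
Qed.

(** Basis-free substitute for X 1 0 = 0: unlike that entry, being scalar survives conjugation and
    the passage from R to R[i]. *)
Definition scalar2 A := [/\ A 0 1 = 0, A 1 0 = 0 & A 0 0 = A 1 1].

(* One of X and Y is a rotation, the other a reflection, so Y^-1 X is a reflection and has a
   fixed vector v; a rotation other than 1 and -1 has no real eigenvector. *)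
Lemma common_vector X Y : orthocols K X -> orthocols K Y -> det2 X != det2 Y ->
  ~ scalar2 X -> ~ scalar2 Y ->
  exists v0 v1, [/\ v0 ^+ 2 + v1 ^+ 2 = 1,
    X 0 0 * v0 + X 0 1 * v1 = Y 0 0 * v0 + Y 0 1 * v1,
    X 1 0 * v0 + X 1 1 * v1 = Y 1 0 * v0 + Y 1 1 * v1
  & v0 * (X 1 0 * v0 + X 1 1 * v1) - v1 * (X 0 0 * v0 + X 0 1 * v1) != 0].
Proof.
wlog dX : X Y / det2 X = 1 => [h hX hY nD sX sY|].
  have [e1|n1] := eqVneq (det2 X) 1; first exact: h.
  have [e2|n2] := eqVneq (det2 Y) 1.
    have [||||||v0 [v1 [v v1E v2E nv]]] := h Y X => //; first by rewrite eq_sym.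
    by exists v0, v1; rewrite -v1E -v2E.
  have [[/eqP h1 _ _ _] [/eqP h2 _ _ _]] := (orthocols_real hX, orthocols_real hY).
  move: h1 h2 nD; rewrite !sqrf_eq1 (negbTE n1) (negbTE n2) /= => /eqP-> /eqP->.
  by rewrite eqxx.
move=> hX hY nD sX _.
have [_ X01 X11 Xn] := orthocols_real hX; have [/eqP Y2 Y01 Y11 Yn] := orthocols_real hY.
have dY : det2 Y = -1.
  by move: Y2; rewrite sqrf_eq1 -dX eq_sym (negbTE nD) /= dX => /eqP.
rewrite dX !mul1r in X01 X11; rewrite dY mulN1r opprK in Y01; rewrite dY mulN1r in Y11.
have c0 : X 1 0 != 0.
  by apply/eqP => c0; apply: sX; rewrite /scalar2 X01 X11 c0 oppr0.
have [v0 [v1 [v e1 e2]]] := unit_kernel c0 Xn Yn.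
exists v0, v1; rewrite X01 X11 Y01 Y11; split => //.
- by move: e1; lra.
- by move: e2; lra.
(* For a rotation the area spanned by v and X v is the sine of the angle, whatever the unit vector
   v. *)
- rewrite (_ : _ - _ = X 1 0 * (v0 ^+ 2 + v1 ^+ 2)); last by ring.
  by rewrite v mulr1.
Qed.

Lemma cplx_mxE A i j : cplx_mx A i j = (A i j)%:C.
Proof. by rewrite mxE. Qed.

Lemma orthocols_cplx X : orthocols KC (cplx_mx X) -> orthocols K X.
Proof.
have hc x : cj KC x%:C = x%:C := cj_emb KC x.
rewrite /orthocols !cplx_mxE !hc => -[h1 h2 h3].
by split; apply: (@complexI R); rewrite rmorphD !rmorphM.
Qed.

Lemma det2_cplx X : det2 (cplx_mx X) = (det2 X)%:C.
Proof. by rewrite /det2 !cplx_mxE rmorphB !rmorphM. Qed.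

(** A scalar matrix is fixed by conjugation, so X would be scalar too, against its nonzero lower
    left entry. *)
Lemma scalar2_cplx (U X : 'M[R[i]]_2) A : orthocols KC U ->
  cplx_mx A = U *m X *m adj KC U -> X 1 0 != 0 -> ~ scalar2 A.
Proof.
move=> /orthocolsP hU e nX [h1 h2 h3].
have eA : cplx_mx A = (A 0 0)%:C *: 1%:M.
  by apply/matrixP; apply: ord2P; apply: ord2P;
    rewrite cplx_mxE [RHS]mxE [X in _ * X]mxE /= ?h1 ?h2 -?h3 ?mulr1 ?mulr0.
have : X = adj KC U *m cplx_mx A *m U.
  by rewrite e !mulmxA hU mul1mx -mulmxA hU mulmx1.
rewrite eA -scalemxAr mulmx1 -scalemxAl hU => eX.
by move: nX; rewrite eX mxE mxE mulr0 eqxx.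
Qed.

(** The complex U serves only to transfer orthogonality, distinct determinants and not being scalar
    to A / r1 and B / r2; [common_vector] then supplies a real basis for [magnus_lt]. *)
Theorem magnusR_lt A B : skew_aligned (cplx_mx A) (cplx_mx B) ->
  magnusR (mexp A *m mexp B) < opnormR A + opnormR B.
Proof.
move=> /skew_aligned_unitary [U [X [Y [r1 [r2 [[hU hX hY]]]]]]].
move=> [[r10 r20 e0 e1 c0] [nD eA eB]].
have hU' : orthocols KC (adj KC U).
  by apply/orthocolsP; rewrite adjK; have /orthocolsP/mulmx1C := hU.
have scaleC r (M : 'M[R]_2) (N : 'M[R[i]]_2) : 0 < r ->
    cplx_mx M = U *m (r%:C *: N) *m adj KC U ->
    cplx_mx (r^-1 *: M) = U *m N *m adj KC U.
  move=> r0 e; rewrite /cplx_mx.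
  have -> : map_mx (fun x : R => Complex x 0) (r^-1 *: M) = (r^-1)%:C *: cplx_mx M.
    by apply/matrixP => i j; rewrite !mxE -[LHS]/((_ * _)%:C) rmorphM.
  rewrite e -scalemxAr -scalemxAl scalerA -rmorphM mulVf ?gt_eqF // rmorph1 scale1r.
  by [].
have eX := scaleC _ _ _ r10 eA; have eY := scaleC _ _ _ r20 eB.
have hXR : orthocols K (r1^-1 *: A).
  by apply: orthocols_cplx; rewrite eX -{1}[U](adjK KC); exact: orthocols_conj.
have hYR : orthocols K (r2^-1 *: B).
  by apply: orthocols_cplx; rewrite eY -{1}[U](adjK KC); exact: orthocols_conj.
have c0' : Y 1 0 != 0 by rewrite e1.
have sX := scalar2_cplx hU eX c0; have sY := scalar2_cplx hU eY c0'.
have nD' : det2 (r1^-1 *: A) != det2 (r2^-1 *: B).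
  apply: contra nD => /eqP/(congr1 (real_complex R)).
  rewrite -!det2_cplx eX eY -{1 3}[U](adjK KC) !det2_conj // => ->.
  by [].
have [v0 [v1 [v ev0 ev1 nv]]] := common_vector hXR hYR nD' sX sY.
(* The rotation taking e1 to v: in its basis the common image of v becomes a common first column,
   and its nonzero component across v the lower left entry. *)
pose V : 'M[R]_2 := mx22 v0 (- v1) v1 v0.
have hV : orthocols K V by rewrite /orthocols /V !mx22E /= -v; split; ring.
have /orthocolsP VV := hV.
have back r (M : 'M[R]_2) : r != 0 ->
    M = V *m (emb K r *: (adj K V *m (r^-1 *: M) *m V)) *m adj K V.
  move=> r0; rewrite -scalemxAr -scalemxAl -!mulmxA (mulmx1C VV) mulmx1 mulmxA (mulmx1C VV).
  by rewrite mul1mx scalerA mulfV // scale1r.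
rewrite /magnusR opnormRE.
have col M i : (adj K V *m M *m V) i 0 =
    V 0 i * (M 0 0 * v0 + M 0 1 * v1) + V 1 i * (M 1 0 * v0 + M 1 1 * v1).
  by rewrite !mul_mxE !adjE /V !mx22E /=; ring.
apply: (magnus_lt hV (orthocols_conj hV hXR) (orthocols_conj hV hYR) r10 r20).
- by rewrite !col ev0 ev1.
- by rewrite !col ev0 ev1.
- by rewrite col /V !mx22E mulNr addrC.
- by rewrite !det2_conj.
- by apply: back; rewrite gt_eqF.
- by apply: back; rewrite gt_eqF.
Qed.

End Real.

Theorem magnusC_lt (R : realType) (A B : 'M[R[i]]_2) : skew_aligned A B ->
  magnusC (mexp A *m mexp B) < opnormC A + opnormC B.
Proof.
move=> /skew_aligned_unitary [U [X [Y [r1 [r2 [[hU hX hY]]]]]]].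
move=> [[r10 r20 e0 e1 c0] [nD eA eB]].
exact: (magnus_lt hU hX hY r10 r20 e0 e1 c0 nD eA eB).
Qed.

Theorem theorem5p4 (R : realType) :
  (forall A B : 'M[R]_2,
     normal_mxR A -> normal_mxR B -> skew_aligned (cplx_mx A) (cplx_mx B) ->
     magnusR (mexp A *m mexp B) < opnormR A + opnormR B) /\
  (forall A B : 'M[R[i]]_2,
     normal_mxC A -> normal_mxC B -> skew_aligned A B ->
     magnusC (mexp A *m mexp B) < opnormC A + opnormC B).
Proof.
by split=> A B _ _; [exact: magnusR_lt|exact: magnusC_lt].
Qed.
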